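(* For $\Gamma>0$ and $\epsilon\in(0,\mathbb E[Y])$, let $R_\epsilon(\Gamma)$ be the rate achieved by the truncated Gaussian policy with parameter $\epsilon$ and buffer size $\Gamma$, namely $R_\epsilon(\Gamma)=I(X;W)$ where $E\sim\pi_\Gamma$ (the unique stationary distribution of the buffer chain defined in the context), $Y$ distributed as $Y_k$, $X'\sim\mathcal N(0,\mathbb E[Y]-\epsilon)$, $N\sim\mathcal N(0,\sigma^2)$, all independent, $X=\mathrm{sgn}(X')\min\{\sqrt{E+Y},|X'|\}$ and $W=X+N$. Let $R(\Gamma)=\sup_{\epsilon\in(0,\mathbb E[Y])}R_\epsilon(\Gamma)$. Then for each $\epsilon$, $\liminf_{\Gamma\to\infty}R_\epsilon(\Gamma)\ge \frac12\log\!\left(1+\frac{\mathbb E[Y]-\epsilon}{\sigma^2}\right)$, and $$\lim_{\Gamma\to\infty}R(\Gamma)=\frac12\log\!\left(1+\frac{\mathbb E[Y]}{\sigma^2}\right).$$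
   Context: $\{Y_k\}$ is an i.i.d. sequence of nonnegative random variables with $\mathbb E[Y_k^2]<\infty$ and $\mathbb E[Y_k]>0$; $\sigma^2>0$. For $\epsilon\in(0,\mathbb E[Y])$ let $\{X'_k\}$ be i.i.d. $\mathcal N(0,\mathbb E[Y]-\epsilon)$, independent of $\{Y_k\}$, and $\eta_k=Y_k-X_k'^2$ (so $\mathbb E[\eta_k]=\epsilon>0$). The truncated Gaussian policy transmits $X_k=\mathrm{sgn}(X'_k)\min\{\sqrt{E_k+Y_k},|X'_k|\}$ (with $\mathrm{sgn}(0)=0$), and the buffer chain with capacity $\Gamma$ is $E_{k+1}(\Gamma)=\min\{\Gamma,\max\{0,E_k(\Gamma)+\eta_{k+1}\}\}$, $E_0(\Gamma)\in[0,\Gamma]$. This chain has a unique stationary distribution $\pi_\Gamma$. *)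

(* Defs.v *)
From HB Require Import structures.
From mathcomp Require Import all_boot all_order all_algebra.
From mathcomp Require Import all_classical all_reals all_analysis.
Set Implicit Arguments. Unset Strict Implicit. Unset Printing Implicit Defensive.
Import Order.TTheory GRing.Theory Num.Def Num.Theory.
Import numFieldNormedType.Exports.
Local Open Scope classical_set_scope.
Local Open Scope ring_scope.

Section energy_harvesting.
Context {R : realType}.

Definition clip (Gamma x : R) : R := Num.min Gamma (Num.max 0 x).

Definition tg_input (e y x' : R) : R := Num.sg x' * Num.min (Num.sqrt (e + y)) `|x'|.

(* law of X' ~ N(0, E[Y] - eps) (normal_prob takes the standard deviation) *)
Definition Xprime_law (mY eps : R) := normal_prob 0 (Num.sqrt (mY - eps)).

Local Open Scope ereal_scope.

(* pi is stationary for the buffer chain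
   E_{k+1} = min{Gamma, max{0, E_k + Y - X'^2}}:
   pi(A) = P(clip(E + Y - X'^2) in A) with E ~ pi, Y ~ nu, X' ~ N(0,mY-eps)
   independent. *)
Definition stationary (nu : probability R R) (mY eps Gamma : R)
  (pi : probability R R) : Prop :=
  forall A : set R, measurable A ->
    pi A = \int[pi]_e \int[nu]_y \int[Xprime_law mY eps]_x'
             (\1_A (clip Gamma (e + (y - x' ^+ 2)%R)) : R)%:E.

Definition W_density (nu : probability R R) (mY sigma eps : R)
  (pi : probability R R) (w : R) : R :=
  fine (\int[pi]_e \int[nu]_y \int[Xprime_law mY eps]_x'
          (normal_pdf (tg_input e y x') sigma w)%:E).

(* mutual information I(X;W) (in nats) for the additive Gaussian channel
   W = X + N, written as E_X[ D( N(X, sigma^2) || P_W ) ], i.e.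
   \int \int p_{W|X}(w|x) log (p_{W|X}(w|x) / p_W(w)) dw dP_X(x). *)
Definition rate (nu : probability R R) (mY sigma eps : R)
  (pi : probability R R) : \bar R :=
  \int[pi]_e \int[nu]_y \int[Xprime_law mY eps]_x'
    \int[lebesgue_measure]_w
      (normal_pdf (tg_input e y x') sigma w *
       ln (normal_pdf (tg_input e y x') sigma w /
           W_density nu mY sigma eps pi w))%:E.

End energy_harvesting.

(* Main.v *)
(** Write P = E[Y] - eps, S = sigma^2 + P, q for the N(0, S) density, f for the
    density of W and phi_x for the N(x, sigma^2) density.  Comparing f with q
    through [ln u <= u - 1] gives the Gaussian maximum entropy bound
    I(X;W) <= ln (S / sigma^2) / 2 as soon as E[X^2] <= P.  Conversely, coupling
    X with X' ~ N(0, P), joint convexity of relative entropy gives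
    D(P_W || N(0, S)) <= E[(X - X')^2] / (2 sigma^2), hence
    I(X;W) >= ln (S / sigma^2) / 2 - delta / sigma^2 whenever E[X'^2 - X^2] and
    E[(X - X')^2] are at most delta.

    The truncation defect is X'^2 - X^2 = (X'^2 - E - Y)^+
    <= exp (- t (E + Y - X'^2)) / t.  For small t > 0 the positive drift makes
    rho = E[exp (- t (Y - X'^2))] < 1, and stationarity yields
    m <= exp (- t Gamma) + rho m for m = E[exp (- t E)]; so the defect is
    O(exp (- t Gamma)). *)
Require Import Defs.
From HB Require Import structures.
From mathcomp Require Import all_boot all_order all_algebra.
From mathcomp Require Import all_classical all_reals all_analysis.
From mathcomp Require Import measurable_realfun.
From mathcomp Require Import ring lra.
Import Order.TTheory GRing.Theory Num.Def Num.Theory.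
Import numFieldNormedType.Exports.
Set Implicit Arguments. Unset Strict Implicit. Unset Printing Implicit Defensive.
Local Open Scope classical_set_scope.
Local Open Scope ring_scope.

(* Exponential tilts of a Gaussian integrate explicitly and lie above their
   tangents in the tilt parameter; this lemma then reads off the moments without
   differentiating under the integral sign. *)
Lemma tangent_unique (R : realType) (V v C d : R) : 0 < d ->
  (forall t : R, `|t| <= d -> t * V <= t * v + C * t ^+ 2) -> V = v.
Proof.
move=> d0 H; apply/eqP; rewrite -subr_eq0 -normr_le0; apply/ler_addgt0Pl => e e0.
rewrite addr0.
pose t := Num.min d (e / (`|C| + 1)).
have C1 : 0 < `|C| + 1 by rewrite ltr_wpDl.
have t0 : 0 < t by rewrite lt_min d0 divr_gt0.
have td : t <= d by rewrite ge_min lexx.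
have Ct : C * t <= e.
  apply: (@le_trans _ _ ((`|C| + 1) * t)).
    by rewrite ler_pM2r// (le_trans (ler_norm _))// lerDl.
  by rewrite -ler_pdivlMl// mulrC ge_min lexx orbT.
have := H t; rewrite gtr0_norm// => /(_ td) H1.
have := H (- t); rewrite normrN gtr0_norm// => /(_ td) H2.
rewrite ler_norml; apply/andP; split.
  rewrite -(ler_pM2l t0); nra.
rewrite -(ler_pM2l t0); nra.
Qed.

(** * Gaussian densities: exponential tilts, moments and convolution *)

Section gaussian.
Context {R : realType}.
Implicit Types m s r t k x w : R.
Local Notation leb := (@lebesgue_measure R).

Lemma integrable_EFinZl k (f : R -> R) :
  leb.-integrable setT (fun x => (f x)%:E) ->
  leb.-integrable setT (fun x => (k * f x)%:E).
Proof. by move=> /(integrableZl measurableT k). Qed.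

Lemma integrable_EFinD (f g : R -> R) :
  leb.-integrable setT (fun x => (f x)%:E) ->
  leb.-integrable setT (fun x => (g x)%:E) ->
  leb.-integrable setT (fun x => (f x + g x)%:E).
Proof. by move=> fi gi; exact: (integrableD measurableT fi gi). Qed.

Lemma le_integrable_EFin (f g : R -> R) :
  measurable_fun setT f -> (forall x, `|f x| <= g x) ->
  leb.-integrable setT (fun x => (g x)%:E) ->
  leb.-integrable setT (fun x => (f x)%:E).
Proof.
move=> mf fg; apply: (@le_integrable _ _ _ leb setT measurableT).
  exact/measurable_EFinP.
by move=> x _; rewrite lee_fin (le_trans (fg x))// ler_norm.
Qed.

Lemma integral_EFinDZ (f g : R -> R) k :
  leb.-integrable setT (fun x => (f x)%:E) ->
  leb.-integrable setT (fun x => (g x)%:E) ->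
  (\int[leb]_x (k * f x + g x)%:E =
   k%:E * \int[leb]_x (f x)%:E + \int[leb]_x (g x)%:E)%E.
Proof.
move=> fi gi; rewrite -integralZl// -integralD//.
exact: integrable_EFinZl.
Qed.

Lemma normal_pdf_gt0 m s x : 0 < s -> 0 < normal_pdf m s x.
Proof.
by move=> s0; rewrite normal_pdfE ?gt_eqF// mulr_gt0 ?expR_gt0// normal_peak_gt0// gt_eqF.
Qed.

Lemma normal_peakE s : 0 < s -> normal_peak s = s^-1 * (Num.sqrt (pi *+ 2))^-1.
Proof.
move=> s0; rewrite /normal_peak -mulrnAr sqrtrM ?sqr_ge0// sqrtr_sqr gtr0_norm//.
by rewrite invfM.
Qed.

(** A quadratic tilt only changes the standard deviation from [s] to [r]; the factor [r / s] is the
    ratio of the normalising constants. *)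
Lemma normal_pdf_square_tilt m s r x : 0 < s -> 0 < r ->
  expR ((s ^- 2 - r ^- 2) / 2 * (x - m) ^+ 2) * normal_pdf m s x =
  r / s * normal_pdf m r x.
Proof.
move=> s0 r0; rewrite !normal_pdfE ?gt_eqF// !normal_peakE// /normal_fun.
rewrite mulrCA -expRD [RHS]mulrA; congr (_ * expR _); first by field; rewrite !gt_eqF// sqrtr_gt0 mulrn_wgt0// pi_gt0.
by field; rewrite !gt_eqF.
Qed.

(** Completing the square turns the linear tilt into a shift of the mean. *)
Lemma normal_pdf_linear_tilt m s t x : 0 < s ->
  expR (t * (x - m)) * normal_pdf m s x =
  expR (t ^+ 2 * s ^+ 2 / 2) * normal_pdf (m + t * s ^+ 2) s x.
Proof.
move=> s0; rewrite !normal_pdfE ?gt_eqF// /normal_fun !(mulrCA (expR _)) -!expRD.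
by congr (_ * expR _); field; rewrite gt_eqF.
Qed.

(** Bayes' rule for a Gaussian input of deviation [s] and Gaussian noise of deviation [r]: the right
    side is the output density times the posterior density of the input, so integrating over [x]
    leaves the output density alone. *)
Lemma normal_pdf_conv s r x w : 0 < s -> 0 < r ->
  let S := Num.sqrt (s ^+ 2 + r ^+ 2) in
  normal_pdf x r w * normal_pdf 0 s x =
  normal_pdf 0 S w * normal_pdf (s ^+ 2 / S ^+ 2 * w) (s * r / S) x.
Proof.
move=> s0 r0 S.
have S0 : 0 < S by rewrite sqrtr_gt0 addr_gt0 ?exprn_gt0.
have S2 : S ^+ 2 = s ^+ 2 + r ^+ 2 by rewrite sqr_sqrtr// addr_ge0 ?sqr_ge0.
have T0 : 0 < s * r / S by rewrite divr_gt0 ?mulr_gt0.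
have p0 : 0 < Num.sqrt (pi *+ 2) :> R by rewrite sqrtr_gt0 mulrn_wgt0// pi_gt0.
rewrite !normal_pdfE ?gt_eqF// !normal_peakE// /normal_fun.
rewrite mulrACA [RHS]mulrACA -!expRD.
congr (_ * expR _); first by field; rewrite !gt_eqF.
have -> : s ^+ 2 = S ^+ 2 - r ^+ 2 by rewrite S2 addrK.
have q0 : S ^+ 2 - r ^+ 2 != 0 by rewrite S2 addrK gt_eqF// exprn_gt0.
have -> : (s * r / S) ^+ 2 = (S ^+ 2 - r ^+ 2) * r ^+ 2 / S ^+ 2.
  by rewrite S2 addrK !exprMn exprVn S2.
by field; rewrite q0 !gt_eqF.
Qed.

Lemma measurable_EFin_normal_pdf m s :
  measurable_fun setT (fun x : R => (normal_pdf m s x)%:E).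
Proof. by apply/measurable_EFinP; exact: measurable_normal_pdf. Qed.

(** The Radon-Nikodym derivative of [normal_prob m s] agrees almost everywhere with
    [normal_pdf m s], since both have the same integral over every measurable set. *)
Lemma ge0_integral_normal_prob m s (f : R -> \bar R) :
  measurable_fun setT f -> (forall x, 0 <= f x)%E ->
  (\int[normal_prob m s]_x f x =
   \int[leb]_x (f x * (normal_pdf m s x)%:E))%E.
Proof.
move=> mf f0; have dom := normal_prob_dominates m s.
rewrite -(Radon_Nikodym_SigmaFinite.change_of_variables dom)//.
have mg : measurable_fun setT (Radon_Nikodym_SigmaFinite.f (normal_prob m s) leb).
  exact: measurable_int (Radon_Nikodym_SigmaFinite.f_integrable dom).
apply: ge0_ae_eq_integral => //.
- exact: emeasurable_funM.
- by apply: emeasurable_funM => //; exact: measurable_EFin_normal_pdf.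
- by move=> x _; rewrite mule_ge0// Radon_Nikodym_SigmaFinite.f_ge0.
- by move=> x _; rewrite mule_ge0// lee_fin normal_pdf_ge0.
apply: ae_eqe_mul2l; apply: integral_ae_eq => //.
- exact: Radon_Nikodym_SigmaFinite.f_integrable.
- exact: measurable_EFin_normal_pdf.
- by move=> E _ mE; rewrite -Radon_Nikodym_SigmaFinite.f_integral.
Qed.

Lemma integral_square_tilt m s r : 0 < s -> 0 < r ->
  (\int[leb]_x (expR ((s ^- 2 - r ^- 2) / 2 * (x - m) ^+ 2) * normal_pdf m s x)%:E
   = (r / s)%:E)%E.
Proof.
move=> s0 r0; under eq_integral do rewrite normal_pdf_square_tilt// EFinM.
by rewrite integralZl ?integral_normal_pdf ?mule1//; exact: integrable_normal_pdf.
Qed.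

Lemma integral_linear_tilt m s t : 0 < s ->
  (\int[leb]_x (expR (t * (x - m)) * normal_pdf m s x)%:E
   = (expR (t ^+ 2 * s ^+ 2 / 2))%:E)%E.
Proof.
move=> s0; under eq_integral do rewrite normal_pdf_linear_tilt// EFinM.
by rewrite integralZl ?integral_normal_pdf ?mule1//; exact: integrable_normal_pdf.
Qed.

Lemma integrable_square_tilt m s r : 0 < s -> 0 < r ->
  leb.-integrable setT
    (fun x => (expR ((s ^- 2 - r ^- 2) / 2 * (x - m) ^+ 2) * normal_pdf m s x)%:E).
Proof.
move=> s0 r0; under eq_fun do rewrite normal_pdf_square_tilt//.
by apply: integrable_EFinZl => //; exact: integrable_normal_pdf.
Qed.

Lemma integrable_linear_tilt m s t : 0 < s ->
  leb.-integrable setT (fun x => (expR (t * (x - m)) * normal_pdf m s x)%:E).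
Proof.
move=> s0; under eq_fun do rewrite normal_pdf_linear_tilt//.
by apply: integrable_EFinZl => //; exact: integrable_normal_pdf.
Qed.

(** With [r = 2 s], the bound [d * u <= expR (d * u)] dominates the square by a quadratic tilt
    already known to be integrable. *)
Lemma integrable_normal_pdf_square m s : 0 < s ->
  leb.-integrable setT (fun x => ((x - m) ^+ 2 * normal_pdf m s x)%:E).
Proof.
move=> s0; have s20 : 0 < s *+ 2 by rewrite mulrn_wgt0.
pose d : R := (s ^- 2 - (s *+ 2) ^- 2) / 2.
have d0 : 0 < d.
  have -> : d = 3 / 8 * s ^- 2 by rewrite /d; field; rewrite gt_eqF.
  by rewrite mulr_gt0// invr_gt0 exprn_gt0.
apply: le_integrable_EFin (integrable_EFinZl d^-1 (integrable_square_tilt m s0 s20)).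
  apply: measurable_funM; last exact: measurable_normal_pdf.
  by apply: measurable_funX; exact: measurable_funB.
move=> x; rewrite ger0_norm ?(mulr_ge0 (sqr_ge0 _) (normal_pdf_ge0 _ _ _))//.
rewrite mulrA ler_wpM2r ?normal_pdf_ge0// mulrC ler_pdivlMr// mulrC.
by apply: le_trans (expR_ge1Dx _); rewrite lerDr.
Qed.

Lemma integrable_normal_pdf_id m s : 0 < s ->
  leb.-integrable setT (fun x => ((x - m) * normal_pdf m s x)%:E).
Proof.
move=> s0.
apply: le_integrable_EFin (integrable_EFinD (@integrable_normal_pdf R m s)
  (integrable_normal_pdf_square m s0)).
  apply: measurable_funM; last exact: measurable_normal_pdf.
  exact: measurable_funB.
move=> x; rewrite normrM (ger0_norm (normal_pdf_ge0 _ _ _)).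
rewrite -{2}[normal_pdf _ _ _]mul1r -mulrDl ler_wpM2r ?normal_pdf_ge0//.
set u := x - m; rewrite -(real_normK (num_real u)); have := normr_ge0 u; nra.
Qed.

(** The tilt with [r = s * (1 + t)] integrates to [1 + t]; bounding it below by its tangent gives
    [d * V <= t] for every small [t] of either sign, where [d] is [t / s ^+ 2] to first order. Then
    [tangent_unique] applies. *)
Lemma integral_normal_pdf_square m s : 0 < s ->
  (\int[leb]_x ((x - m) ^+ 2 * normal_pdf m s x)%:E = (s ^+ 2)%:E)%E.
Proof.
move=> s0; have i2 := integrable_normal_pdf_square m s0.
have /fineK <- := integrable_fin_num measurableT i2.
congr EFin; set V := fine _.
have V0 : 0 <= V.
  by apply/fine_ge0/integral_ge0 => x _; rewrite lee_fin (mulr_ge0 (sqr_ge0 _)) ?normal_pdf_ge0.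
apply: (@tangent_unique _ _ _ (3 * s ^+ 2) (1 / 2)) => // t t12.
have {t12} /andP[t1 t2] : - (1 / 2) <= t <= 1 / 2 by rewrite -ler_norml.
have t0 : 0 < 1 + t by lra.
have st0 : 0 < s * (1 + t) by rewrite mulr_gt0.
pose d : R := (s ^- 2 - (s * (1 + t)) ^- 2) / 2.
have dV : d * V + 1 <= 1 + t.
  rewrite -lee_fin EFinD EFinM fineK ?(integrable_fin_num measurableT i2)//.
  have -> : 1 + t = s * (1 + t) / s by rewrite mulrAC divff ?mul1r ?gt_eqF.
  rewrite -(integral_normal_pdf m s) -integral_EFinDZ//; last exact: integrable_normal_pdf.
  rewrite -(integral_square_tilt m s0 st0); apply: le_integral => //.
  - by apply: integrable_EFinD; [exact: integrable_EFinZl|exact: integrable_normal_pdf].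
  - exact: integrable_square_tilt.
  - move=> x _; rewrite lee_fin mulrA -{2}[normal_pdf _ _ _]mul1r -mulrDl.
    by rewrite ler_wpM2r ?normal_pdf_ge0// addrC expR_ge1Dx.
have H : (2 * t + t ^+ 2) * V <= 2 * s ^+ 2 * t * (1 + t) ^+ 2.
  have -> : 2 * t + t ^+ 2 = d * (2 * s ^+ 2 * (1 + t) ^+ 2).
    by rewrite /d; field; rewrite !gt_eqF.
  have p0 : 0 < 2 * s ^+ 2 * (1 + t) ^+ 2 by rewrite !mulr_gt0 ?exprn_gt0.
  rewrite [leRHS](_ : _ = t * (2 * s ^+ 2 * (1 + t) ^+ 2)); last by ring.
  by rewrite mulrAC ler_pM2r//; lra.
have := sqr_ge0 t; have := sqr_ge0 s => s2 tt.
have : 0 <= t ^+ 2 * V by rewrite mulr_ge0.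
have : 0 <= s ^+ 2 * t ^+ 2 * (1 - t) by rewrite mulr_ge0 ?(mulr_ge0 s2 tt)//; lra.
by move: H; nra.
Qed.

Lemma integral_normal_pdf_id m s : 0 < s ->
  (\int[leb]_x ((x - m) * normal_pdf m s x)%:E = 0)%E.
Proof.
move=> s0; have i1 := integrable_normal_pdf_id m s0.
have /fineK <- := integrable_fin_num measurableT i1.
congr EFin; set V := fine _.
apply: (@tangent_unique _ _ _ (s ^+ 2) (s^-1)); rewrite ?invr_gt0// => t ts.
have u1 : t ^+ 2 * s ^+ 2 <= 1.
  rewrite -exprMn -(real_normK (num_real (t * s))) expr_le1// normrM (gtr0_norm s0).
  by rewrite -ler_pdivlMr// mul1r.
have dV : t * V + 1 <= expR (t ^+ 2 * s ^+ 2 / 2).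
  rewrite -lee_fin EFinD EFinM fineK ?(integrable_fin_num measurableT i1)//.
  rewrite -(integral_normal_pdf m s) -integral_EFinDZ//; last exact: integrable_normal_pdf.
  rewrite -(integral_linear_tilt m t s0); apply: le_integral => //.
  - by apply: integrable_EFinD; [exact: integrable_EFinZl|exact: integrable_normal_pdf].
  - exact: integrable_linear_tilt.
  - move=> x _; rewrite lee_fin mulrA -{2}[normal_pdf _ _ _]mul1r -mulrDl.
    by rewrite ler_wpM2r ?normal_pdf_ge0// addrC expR_ge1Dx.
have u0 : 0 <= t ^+ 2 * s ^+ 2 by exact: mulr_ge0 (sqr_ge0 _) (sqr_ge0 _).
set u := t ^+ 2 * s ^+ 2 in u0 u1 dV *.
have e0 := expR_gt0 (u / 2).
(* As [u <= 1], this gives [expR (u / 2) <= 1 + u], a remainder quadratic in [t], as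
   [tangent_unique] requires. *)
have eu : expR (u / 2) * (1 - u / 2) <= 1.
  rewrite -[leRHS](expR0 R) -(subrr (u / 2)) expRD ler_pM2l//.
  exact: expR_ge1Dx.
have -> : s ^+ 2 * t ^+ 2 = u by rewrite mulrC.
nra.
Qed.

Lemma normal_pdf_quadraticE m s (a b c : R) w :
  normal_pdf m s w * (a + b * w + c * w ^+ 2) =
  (a + b * m + c * m ^+ 2) * normal_pdf m s w +
   ((b + 2 * c * m) * ((w - m) * normal_pdf m s w) +
   c * ((w - m) ^+ 2 * normal_pdf m s w)).
Proof. by ring. Qed.

Lemma integrable_normal_pdf_quadratic m s (a b c : R) : 0 < s ->
  leb.-integrable setT (fun w => (normal_pdf m s w * (a + b * w + c * w ^+ 2))%:E).
Proof.
move=> s0; under eq_fun do rewrite normal_pdf_quadraticE.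
apply: integrable_EFinD; first by apply: integrable_EFinZl; exact: integrable_normal_pdf.
apply: integrable_EFinD; apply: integrable_EFinZl.
- exact: integrable_normal_pdf_id.
- exact: integrable_normal_pdf_square.
Qed.

Lemma integral_normal_pdf_quadratic m s (a b c : R) : 0 < s ->
  (\int[leb]_w (normal_pdf m s w * (a + b * w + c * w ^+ 2))%:E =
   (a + b * m + c * (s ^+ 2 + m ^+ 2))%:E)%E.
Proof.
move=> s0.
have i0 := @integrable_normal_pdf R m s.
have i1 := integrable_normal_pdf_id m s0.
have i2 := integrable_normal_pdf_square m s0.
under eq_integral do rewrite normal_pdf_quadraticE.
have ci2 := integrable_EFinZl c i2.
rewrite integral_EFinDZ//; last by apply: integrable_EFinD => //; exact: integrable_EFinZl.
rewrite integral_EFinDZ// integral_normal_pdf integral_normal_pdf_id//.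
under [X in (_ + (_ + X))%E]eq_integral do rewrite EFinM.
rewrite integralZl// integral_normal_pdf_square// mule0 add0e mule1 -EFinM -EFinD.
by congr EFin; ring.
Qed.

(** Used for the ideal input X', whose output is the Gaussian reference density. *)
Lemma normal_prob_conv s r w : 0 < s -> 0 < r ->
  (\int[normal_prob 0 s]_x (normal_pdf x r w)%:E =
   (normal_pdf 0 (Num.sqrt (s ^+ 2 + r ^+ 2)) w)%:E)%E.
Proof.
move=> s0 r0; rewrite ge0_integral_normal_prob//.
- under eq_integral do rewrite -EFinM normal_pdf_conv// EFinM.
  by rewrite integralZl ?integral_normal_pdf ?mule1//; exact: integrable_normal_pdf.
- apply/measurable_EFinP; under eq_fun do rewrite normal_pdfE ?gt_eqF//.
  apply: measurable_funM => //; apply: measurableT_comp => //.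
  apply: measurable_funM => //; apply: measurableT_comp => //.
  by apply: measurable_funX; exact: measurable_funB.
- by move=> x; rewrite lee_fin normal_pdf_ge0.
Qed.

Lemma normal_prob_square s : 0 < s ->
  (\int[normal_prob 0 s]_x (x ^+ 2)%:E = (s ^+ 2)%:E)%E.
Proof.
move=> s0; rewrite ge0_integral_normal_prob//.
- have := @integral_normal_pdf_quadratic 0 s 0 0 1 s0.
  rewrite !(mul0r, mul1r, add0r) expr0n addr0 => <-.
  by apply: eq_integral => x _; rewrite !(mul0r, mul1r, add0r) EFinM muleC.
- exact/measurable_EFinP/measurable_funX.
- by move=> x; rewrite lee_fin sqr_ge0.
Qed.

Lemma normal_prob_square_tilt s r : 0 < s -> 0 < r ->
  (\int[normal_prob 0 s]_x (expR ((s ^- 2 - r ^- 2) / 2 * x ^+ 2))%:E =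
   (r / s)%:E)%E.
Proof.
move=> s0 r0; rewrite ge0_integral_normal_prob//.
- rewrite -(integral_square_tilt 0 s0 r0).
  by apply: eq_integral => x _; rewrite subr0.
- apply/measurable_EFinP; apply: measurableT_comp => //.
  by apply: measurable_funM => //; exact: measurable_funX.
Qed.

End gaussian.


(** * Relative entropy of a Gaussian from a general output density *)

Section relative_entropy.
Context {R : realType}.
Implicit Types m s x y w : R.
Local Notation leb := (@lebesgue_measure R).

Lemma ln_normal_pdf m s w : 0 < s ->
  ln (normal_pdf m s w) = ln (normal_peak s) - (w - m) ^+ 2 / (2 * s ^+ 2).
Proof.
move=> s0; rewrite normal_pdfE ?gt_eqF// lnM ?posrE ?normal_peak_gt0 ?expR_gt0 ?gt_eqF//.
by rewrite /normal_fun expRK mulNr mulr_natl.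
Qed.

Lemma ln_normal_peak_ratio s S : 0 < s -> 0 < S ->
  ln (normal_peak s) - ln (normal_peak (Num.sqrt S)) = ln (S / s ^+ 2) / 2.
Proof.
move=> s0 S0; have r0 : 0 < Num.sqrt S by rewrite sqrtr_gt0.
have p0 : 0 < Num.sqrt (pi *+ 2) :> R by rewrite sqrtr_gt0 mulrn_wgt0// pi_gt0.
rewrite !normal_peakE// !lnM ?posrE ?invr_gt0 ?exprn_gt0// !lnV ?posrE ?exprn_gt0//.
rewrite -{2}(sqr_sqrtr (ltW S0)) !lnXn//; lra.
Qed.

Lemma measurable_normal_pdf_comp d (T : measurableType d) (g h : T -> R) s :
  0 < s -> measurable_fun setT g -> measurable_fun setT h ->
  measurable_fun setT (fun z => normal_pdf (g z) s (h z)).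
Proof.
move=> s0 mg mh; under eq_fun do rewrite normal_pdfE ?gt_eqF//.
apply: measurable_funM => //; apply: measurableT_comp => //.
apply: measurable_funM => //; apply: measurableT_comp => //.
by apply: measurable_funX; exact: measurable_funB.
Qed.

(** When [h] has infinite integral the bound is trivial, so the ratios [q / f] and [f / q] can be
    handled later without proving them integrable. *)
Lemma le_integral_ge0D (f g h : R -> R) :
  leb.-integrable setT (fun x => (f x)%:E) ->
  leb.-integrable setT (fun x => (g x)%:E) ->
  measurable_fun setT h -> (forall x, 0 <= h x) ->
  (forall x, f x <= g x + h x) ->
  (\int[leb]_x (f x)%:E <= \int[leb]_x (g x)%:E + \int[leb]_x (h x)%:E)%E.
Proof.
move=> fi gi mh h0 fgh.
have H0 : (0 <= \int[leb]_x (h x)%:E)%E by apply: integral_ge0 => x _; rewrite lee_fin.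
have mEh : measurable_fun [set: R] (fun x => (h x)%:E) by exact/measurable_EFinP.
have [hoo|hoo] := eqVneq (\int[leb]_x (h x)%:E)%E +oo%E.
  by rewrite hoo -(fineK (integrable_fin_num measurableT gi)) addey ?leey.
have hi : leb.-integrable setT (fun x => (h x)%:E).
  apply/integrableP; split; first exact: mEh.
  by under eq_integral do rewrite gee0_abs ?lee_fin//; rewrite ltey.
rewrite -integralD//; apply: le_integral => //; first exact: integrable_EFinD.
by move=> x _; rewrite -EFinD lee_fin.
Qed.

Lemma ln_le_subr1 x : 0 < x -> ln x <= x - 1.
Proof. by move=> x0; have := @le_ln1Dx R (x - 1); rewrite (addrC 1) subrK; apply; lra. Qed.

Section kl.
Variables (f : R -> R) (s c k : R).
Hypotheses (mf : measurable_fun setT f) (s0 : 0 < s) (c0 : 0 < c) (k0 : 0 <= k).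
Hypotheses (f_ge : forall w, c * expR (- k * w ^+ 2) <= f w).
Hypotheses (f_le : forall w, f w <= normal_peak s).
Hypothesis (f1 : (\int[leb]_w (f w)%:E = 1)%E).

(** Relative entropy of N(x, s^2) from the density [f]. The Gaussian lower bound and the constant
    upper bound assumed on [f] are those met by the output density of an input of bounded power. *)
Definition kl x :=
  (\int[leb]_w (normal_pdf x s w * ln (normal_pdf x s w / f w))%:E)%E.

Let f_gt0 w : 0 < f w.
Proof. by apply: lt_le_trans (f_ge w); rewrite mulr_gt0 ?expR_gt0. Qed.

Let phi0 x w : 0 < normal_pdf x s w. Proof. exact: normal_pdf_gt0. Qed.

Let mln d (T : measurableType d) (g h : T -> R) :
  measurable_fun setT g -> measurable_fun setT h ->
  measurable_fun setT
    (fun z => normal_pdf (g z) s (h z) * ln (normal_pdf (g z) s (h z) / f (h z))).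
Proof.
move=> mg mh; have m1 := measurable_normal_pdf_comp s0 mg mh.
apply: measurable_funM => //; apply: measurableT_comp => //.
(* The reciprocal of the positive function [f] becomes [expR (- ln f)], measurable by
   composition. *)
under eq_fun do rewrite -(lnK (f_gt0 _)) -expRN.
apply: measurable_funM => //; apply: measurableT_comp => //.
by apply: measurableT_comp => //; apply: measurableT_comp => //; exact: measurableT_comp.
Qed.

(** The bounds on [f] place [ln (f w)] between [ln c - k * w ^+ 2] and [ln (normal_peak s)], so a
    Gaussian density times a quadratic polynomial dominates the integrand. *)
Lemma integrable_kl x :
  leb.-integrable setT
    (fun w => (normal_pdf x s w * ln (normal_pdf x s w / f w))%:E).
Proof.
pose a := `|ln (normal_peak s) - ln c|.
have H := integrable_normal_pdf_quadratic x (a + x ^+ 2 / (2 * s ^+ 2))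
  (- x / s ^+ 2) (k + 1 / (2 * s ^+ 2)) s0.
apply: le_integrable_EFin H; first exact: mln.
move=> w; rewrite normrM gtr0_norm//; apply: ler_wpM2l; first exact: ltW.
have -> : a + x ^+ 2 / (2 * s ^+ 2) + - x / s ^+ 2 * w + (k + 1 / (2 * s ^+ 2)) * w ^+ 2
  = a + k * w ^+ 2 + (w - x) ^+ 2 / (2 * s ^+ 2) by field; rewrite gt_eqF.
have a0 : 0 <= a by exact: normr_ge0.
have al := ler_norm (ln (normal_peak s) - ln c); rewrite -/a in al.
have kw : 0 <= k * w ^+ 2 by rewrite mulr_ge0 ?sqr_ge0.
have q0 : 0 <= (w - x) ^+ 2 / (2 * s ^+ 2) by rewrite divr_ge0 ?sqr_ge0// mulr_ge0 ?sqr_ge0.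
have pk : 0 < normal_peak s by rewrite normal_peak_gt0 ?gt_eqF.
have l1 : ln (f w) <= ln (normal_peak s) by rewrite ler_ln ?posrE.
have l2 : ln c - k * w ^+ 2 <= ln (f w).
  have := f_ge w; rewrite -ler_ln ?posrE ?mulr_gt0 ?expR_gt0//.
  by rewrite lnM ?posrE ?expR_gt0// expRK mulNr.
rewrite ln_div ?posrE// ln_normal_pdf// ler_norml; apply/andP; split; lra.
Qed.

(* Adding [f - normal_pdf x s], of integral 0, makes the integrand nonnegative,
   so that Tonelli applies. *)
Lemma klE x : kl x = (\int[leb]_w (normal_pdf x s w * ln (normal_pdf x s w / f w)
  - normal_pdf x s w + f w)%:E)%E.
Proof.
have fi : leb.-integrable setT (fun w => (f w)%:E).
  apply/integrableP; split; first exact/measurable_EFinP.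
  by under eq_integral do rewrite gee0_abs ?lee_fin ?ltW//; rewrite f1 ltry.
have pi := @integrable_normal_pdf R x s.
under eq_integral do rewrite -addrA addrC -mulN1r.
have ki := integrable_kl x.
under eq_integral do rewrite -addrA.
rewrite integral_EFinDZ//; last exact: integrable_EFinD.
rewrite integral_normal_pdf mule1.
under [X in (_ + X)%E]eq_integral do rewrite EFinD.
by rewrite integralD// f1 addeA -EFinD addNr add0e.
Qed.

(** This is [ln u <= u - 1] at [u = f w / normal_pdf x s w], multiplied by [normal_pdf x s w]. *)
Let kl_integrand_ge0 x w : 0 <= normal_pdf x s w * ln (normal_pdf x s w / f w)
  - normal_pdf x s w + f w.
Proof.
have := ln_le_subr1 (divr_gt0 (f_gt0 w) (phi0 x w)).
rewrite -[ln (f w / _)]opprK -lnV ?posrE ?divr_gt0// invf_div => H.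
have := ler_wpM2l (ltW (phi0 x w)) H.
by rewrite mulrN mulrBr mulr1 mulrCA divff ?gt_eqF// mulr1; lra.
Qed.

Lemma kl_ge0 x : (0 <= kl x)%E.
Proof. by rewrite klE; apply: integral_ge0 => w _; rewrite lee_fin. Qed.

Lemma measurable_kl d (T : measurableType d) (X : T -> R) :
  measurable_fun setT X -> measurable_fun setT (fun z => kl (X z)).
Proof.
move=> mX; under eq_fun do rewrite klE.
apply: (measurable_fun_fubini_tonelli_F (m2 := leb) (fun p : T * R =>
  (normal_pdf (X p.1) s p.2 * ln (normal_pdf (X p.1) s p.2 / f p.2)
  - normal_pdf (X p.1) s p.2 + f p.2)%:E)).
  apply/measurable_EFinP.
  have m1 : measurable_fun setT (fun p : T * R => X p.1) by exact: measurableT_comp.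
  have m2 : measurable_fun setT (fun p : T * R => p.2) by exact: measurable_snd.
  apply: measurable_funD; last exact: measurableT_comp.
  by apply: measurable_funB; [exact: mln|exact: measurable_normal_pdf_comp].
by move=> p; rewrite lee_fin.
Qed.

Variable (S : R).
Hypothesis S0 : 0 < S.
Let q := normal_pdf 0 (Num.sqrt S).
Let q0 w : 0 < q w. Proof. by rewrite normal_pdf_gt0 ?sqrtr_gt0. Qed.
Let L := ln (S / s ^+ 2) / 2.

Let lnq y w : ln (normal_pdf y s w / q w) =
  L - (w - y) ^+ 2 / (2 * s ^+ 2) + w ^+ 2 / (2 * S).
Proof.
rewrite ln_div ?posrE// !ln_normal_pdf ?sqrtr_gt0// sqr_sqrtr ?ltW//.
by rewrite /L -ln_normal_peak_ratio// subr0; lra.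
Qed.

(** Split [ln (phi_x / f)] as [ln (phi_x / q) + ln (q / f)] and apply [ln u <= u - 1] to the second
    term. The first integrates to an explicit relative entropy between Gaussians; the last integral
    averages to 1 over the inputs. *)
Lemma kl_le x :
  (kl x + 1 <= (L + (s ^+ 2 + x ^+ 2) / (2 * S) - 1 / 2)%:E +
    \int[leb]_w (normal_pdf x s w * (q w / f w))%:E)%E.
Proof.
have k1 : (kl x + 1 = \int[leb]_w
   (normal_pdf x s w * ln (normal_pdf x s w / f w) + normal_pdf x s w)%:E)%E.
  rewrite -(integral_normal_pdf x s).
  under [in RHS]eq_integral do rewrite EFinD.
  by rewrite integralD//; [exact: integrable_kl|exact: integrable_normal_pdf].
(* The coefficients are arranged as in [integral_normal_pdf_quadratic], which is then rewritten from
   right to left. *)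
have -> : L + (s ^+ 2 + x ^+ 2) / (2 * S) - 1 / 2 =
   (L - x ^+ 2 / (2 * s ^+ 2)) + (x / s ^+ 2) * x +
   (1 / (2 * S) - 1 / (2 * s ^+ 2)) * (s ^+ 2 + x ^+ 2).
  by field; rewrite !gt_eqF.
rewrite k1 -integral_normal_pdf_quadratic//; apply: le_integral_ge0D.
- by apply: integrable_EFinD; [exact: integrable_kl|exact: integrable_normal_pdf].
- exact: integrable_normal_pdf_quadratic.
- apply: measurable_funM; first exact: measurable_normal_pdf.
  under eq_fun do rewrite -(lnK (f_gt0 _)) -expRN.
  apply: measurable_funM; first exact: measurable_normal_pdf.
  by apply: measurableT_comp => //; apply: measurableT_comp => //; exact: measurableT_comp.
- by move=> w; rewrite mulr_ge0 ?divr_ge0 ?ltW.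
move=> w; rewrite -[X in _ + X <= _]mulr1 -!mulrDr; apply: ler_wpM2l; first exact: ltW.
have := ln_le_subr1 (divr_gt0 (q0 w) (f_gt0 w)).
have := lnq x w; rewrite !ln_div ?posrE// => E1 E2.
have -> : L - x ^+ 2 / (2 * s ^+ 2) + x / s ^+ 2 * w +
   (1 / (2 * S) - 1 / (2 * s ^+ 2)) * w ^+ 2 =
   L - (w - x) ^+ 2 / (2 * s ^+ 2) + w ^+ 2 / (2 * S).
  by field; rewrite !gt_eqF.
by rewrite -E1; lra.
Qed.

(* Pointwise form of the joint convexity of relative entropy: [y] is the input
   coupled with [x], and the last integral averages to 1 when the mixture of
   [normal_pdf y s] is [q]. *)
Lemma kl_ge x y :
  ((L + 1 / 2 - (x - y) ^+ 2 / (2 * s ^+ 2) + (s ^+ 2 + x ^+ 2) / (2 * S))%:E <=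
    kl x + \int[leb]_w (normal_pdf y s w * (f w / q w))%:E)%E.
Proof.
have -> : L + 1 / 2 - (x - y) ^+ 2 / (2 * s ^+ 2) + (s ^+ 2 + x ^+ 2) / (2 * S) =
   (L + 1 - y ^+ 2 / (2 * s ^+ 2)) + (y / s ^+ 2) * x +
   (1 / (2 * S) - 1 / (2 * s ^+ 2)) * (s ^+ 2 + x ^+ 2).
  by field; rewrite !gt_eqF.
rewrite -integral_normal_pdf_quadratic//; apply: le_integral_ge0D.
- exact: integrable_normal_pdf_quadratic.
- exact: integrable_kl.
- apply: measurable_funM; first exact: measurable_normal_pdf.
  under eq_fun do rewrite -(lnK (q0 _)) -expRN.
  apply: measurable_funM => //.
  apply: measurableT_comp => //; apply: measurableT_comp => //.
  by apply: measurableT_comp => //; exact: measurable_normal_pdf.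
- by move=> w; rewrite mulr_ge0 ?divr_ge0 ?ltW.
move=> w.
have -> : L + 1 - y ^+ 2 / (2 * s ^+ 2) + y / s ^+ 2 * w +
   (1 / (2 * S) - 1 / (2 * s ^+ 2)) * w ^+ 2 =
   1 + (L - (w - y) ^+ 2 / (2 * s ^+ 2) + w ^+ 2 / (2 * S)).
  by field; rewrite !gt_eqF.
rewrite -lnq.
(* [ln u <= u - 1] is used at [u = phi_y f / (q phi_x)] and multiplied by phi_x: the logarithm is
   [ln (phi_y / q) - ln (phi_x / f)]. *)
have a0 : 0 < normal_pdf y s w * (f w / q w) / normal_pdf x s w.
  by rewrite !(divr_gt0, mulr_gt0).
have := ler_wpM2l (ltW (phi0 x w)) (ln_le_subr1 a0).
rewrite mulrBr [X in _ <= X - _]mulrC divfK ?gt_eqF//.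
rewrite !(ln_div, lnM) ?posrE// ?(mulr_gt0, divr_gt0, invr_gt0)//.
by rewrite mulr1; nra.
Qed.

End kl.

End relative_entropy.

(** * Additive Gaussian noise channel with a power-constrained input *)

Section channel.
Context d (T : measurableType d) {R : realType} (mu : probability T R).
Implicit Types (X Y : T -> R) (w : R).
Local Notation leb := (@lebesgue_measure R).

Lemma probability_integral_cst (c : R) : (\int[mu]_z c%:E = c%:E)%E.
Proof. by rewrite integral_cst// -[RHS]mule1; congr (_ * _)%E; exact: probability_setT. Qed.

Lemma ge0_integral_affine (a b : R) (Q H : T -> \bar R) :
  0 <= a -> 0 <= b ->
  measurable_fun setT Q -> (forall z, 0 <= Q z)%E ->
  measurable_fun setT H -> (forall z, 0 <= H z)%E ->
  (\int[mu]_z (a%:E + b%:E * Q z + H z) =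
   a%:E + b%:E * \int[mu]_z Q z + \int[mu]_z H z)%E.
Proof.
move=> a0 b0 mQ Q0 mH H0; have mbQ := measurable_funeM b%:E mQ.
have bQ0 z : (0 <= b%:E * Q z)%E by rewrite mule_ge0// lee_fin.
rewrite ge0_integralD//; last 2 first.
- by move=> z _; rewrite adde_ge0// lee_fin.
- exact: emeasurable_funD.
rewrite ge0_integralD// probability_integral_cst.
by rewrite ge0_integralZl_EFin.
Qed.

Lemma measurable_EFin_normal_pdf_comp d' (T' : measurableType d') (g h : T' -> R) (s : R) :
  0 < s -> measurable_fun setT g -> measurable_fun setT h ->
  measurable_fun setT (fun z => (normal_pdf (g z) s (h z))%:E).
Proof. by move=> s0 mg mh; apply/measurable_EFinP; exact: measurable_normal_pdf_comp. Qed.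

(** Tonelli's theorem makes the output density appear under the integral; it serves with [g] equal
    to 1, [q / f] and [f / q]. *)
Lemma normal_mixture_swap X (s : R) (g : R -> R) : 0 < s ->
  measurable_fun setT X -> measurable_fun setT g -> (forall w, 0 <= g w) ->
  (\int[mu]_z \int[leb]_w (normal_pdf (X z) s w * g w)%:E =
   \int[leb]_w (\int[mu]_z (normal_pdf (X z) s w)%:E * (g w)%:E))%E.
Proof.
move=> s0 mX mg g0.
rewrite (@fubini_tonelli _ _ _ _ _ mu leb
  (fun p : T * R => (normal_pdf (X p.1) s p.2 * g p.2)%:E)).
- apply: eq_integral => w _.
  rewrite -ge0_integralZr// ?lee_fin//.
  + exact: measurable_EFin_normal_pdf_comp.
  + by move=> z _; rewrite lee_fin normal_pdf_ge0.
- apply/measurable_EFinP; apply: measurable_funM; last exact: measurableT_comp.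
  by apply: measurable_normal_pdf_comp => //; exact: measurableT_comp.
- by move=> p; rewrite lee_fin mulr_ge0 ?normal_pdf_ge0.
Qed.

Definition output_density X (s w : R) : R :=
  fine (\int[mu]_z (normal_pdf (X z) s w)%:E)%E.

Variables (X : T -> R) (s P : R).
Hypotheses (mX : measurable_fun setT X) (s0 : 0 < s) (P0 : 0 < P).
Hypothesis X2 : (\int[mu]_z (X z ^+ 2)%:E <= P%:E)%E.

Local Notation f := (output_density X s).
Let S := s ^+ 2 + P.
Let S0 : 0 < S. Proof. by rewrite addr_gt0 ?exprn_gt0. Qed.
Let q := normal_pdf 0 (Num.sqrt S).
Let q0 w : 0 < q w. Proof. by rewrite normal_pdf_gt0 ?sqrtr_gt0. Qed.

Let mX2 : measurable_fun [set: T] (fun z => (X z ^+ 2)%:E).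
Proof. by apply/measurable_EFinP; exact: measurable_funX. Qed.

Let int_pdf_le w : (\int[mu]_z (normal_pdf (X z) s w)%:E <= (normal_peak s)%:E)%E.
Proof.
rewrite -probability_integral_cst; apply: ge0_le_integral => //.
- by move=> z _; rewrite lee_fin normal_pdf_ge0.
- exact: measurable_EFin_normal_pdf_comp.
- by move=> z _; rewrite lee_fin normal_pdf_ub// gt_eqF.
Qed.

Lemma output_densityE w : (f w)%:E = (\int[mu]_z (normal_pdf (X z) s w)%:E)%E.
Proof.
rewrite fineK// ge0_fin_numE; first by rewrite (le_lt_trans (int_pdf_le w)) ?ltry.
by apply: integral_ge0 => z _; rewrite lee_fin normal_pdf_ge0.
Qed.

Lemma output_density_le w : f w <= normal_peak s.
Proof. by rewrite -lee_fin output_densityE. Qed.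

(* Jensen's inequality for the exponential, through its tangent at [- P / s ^+ 2] *)
Lemma output_density_ge w :
  normal_peak s * expR (- P / s ^+ 2) * expR (- s ^- 2 * w ^+ 2) <= f w.
Proof.
pose B : R := normal_peak s * expR (- P / s ^+ 2) * expR (- s ^- 2 * w ^+ 2); rewrite -/B.
have pk : 0 < normal_peak s by rewrite normal_peak_gt0 ?gt_eqF.
have B0 : 0 < B by rewrite !mulr_gt0 ?expR_gt0.
have k0 : 0 < s ^- 2 by rewrite invr_gt0 exprn_gt0.
(* The tangent bound to be integrated is [B * (1 + (P - X z ^+ 2) / s ^+ 2) <= normal_pdf (X z) s
   w], and the power constraint makes the mean of its left side at least [B]. The negative term is
   moved across to keep all integrands nonnegative. *)
suff : ((B * (1 + P * s ^- 2))%:E <= (f w)%:E + (B * s ^- 2)%:E * P%:E)%E.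
  by rewrite -EFinM -EFinD lee_fin; lra.
apply: (@le_trans _ _ ((f w)%:E + (B * s ^- 2)%:E * \int[mu]_z (X z ^+ 2)%:E)%E); last first.
  by rewrite leeD2l// lee_wpmul2l// lee_fin ltW// mulr_gt0.
rewrite output_densityE -ge0_integralZl_EFin//; last 2 first.
- by move=> z _; rewrite lee_fin sqr_ge0.
- by rewrite ltW// mulr_gt0.
rewrite -ge0_integralD//; last 4 first.
- by move=> z _; rewrite lee_fin normal_pdf_ge0.
- exact: measurable_EFin_normal_pdf_comp.
- by move=> z _; rewrite -EFinM lee_fin (mulr_ge0 _ (sqr_ge0 _))// ltW// mulr_gt0.
- exact: measurable_funeM.
rewrite -probability_integral_cst; apply: ge0_le_integral => //.
- by move=> z _; rewrite lee_fin ltW// mulr_gt0// addr_gt0// mulr_gt0.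
- apply: emeasurable_funD; first exact: measurable_EFin_normal_pdf_comp.
  exact: measurable_funeM.
move=> z _; rewrite -EFinM -EFinD lee_fin normal_pdfE ?gt_eqF// /normal_fun.
have H : B * (1 + (P * s ^- 2 - s ^- 2 * X z ^+ 2)) <=
    normal_peak s * expR (- s ^- 2 * w ^+ 2 - s ^- 2 * X z ^+ 2).
  have -> : normal_peak s * expR (- s ^- 2 * w ^+ 2 - s ^- 2 * X z ^+ 2) =
      B * expR (P * s ^- 2 - s ^- 2 * X z ^+ 2).
    rewrite /B -!mulrA -!expRD; congr (_ * expR _); field; by rewrite gt_eqF.
  by rewrite ler_pM2l// expR_ge1Dx.
(* In the exponent this is [(w - X z) ^+ 2 <= 2 * (w ^+ 2 + X z ^+ 2)]. *)
have H2 : normal_peak s * expR (- s ^- 2 * w ^+ 2 - s ^- 2 * X z ^+ 2) <=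
    normal_peak s * expR (- (w - X z) ^+ 2 / (s ^+ 2 *+ 2)).
  rewrite ler_pM2l// ler_expR -subr_ge0.
  have -> : - (w - X z) ^+ 2 / (s ^+ 2 *+ 2) - (- s ^- 2 * w ^+ 2 - s ^- 2 * X z ^+ 2) =
      (w + X z) ^+ 2 / (s ^+ 2 *+ 2) by field; rewrite gt_eqF.
  by rewrite divr_ge0 ?sqr_ge0// mulrn_wge0// sqr_ge0.
lra.
Qed.

Lemma output_density_gt0 w : 0 < f w.
Proof.
apply: lt_le_trans (output_density_ge w).
by rewrite !mulr_gt0 ?expR_gt0// normal_peak_gt0 ?gt_eqF.
Qed.

Lemma measurable_output_density : measurable_fun setT f.
Proof.
apply/measurable_EFinP.
have -> : EFin \o f = (fun w => \int[mu]_z (normal_pdf (X z) s w)%:E)%E.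
  by apply/funext => w /=; rewrite output_densityE.
apply: (measurable_fun_fubini_tonelli_F (m2 := mu)
  (fun p : R * T => (normal_pdf (X p.2) s p.1)%:E)).
- by apply: measurable_EFin_normal_pdf_comp => //; exact: measurableT_comp.
- by move=> p; rewrite lee_fin normal_pdf_ge0.
Qed.

Lemma integral_output_density : (\int[leb]_w (f w)%:E = 1)%E.
Proof.
have := @normal_mixture_swap X s (cst 1) s0 mX (measurable_cst _) (fun=> ler01).
under [in RHS]eq_integral do rewrite mule1 -output_densityE.
move=> <-; under eq_integral.
  move=> z _; under eq_integral do rewrite mulr1.
  by rewrite integral_normal_pdf; over.
exact: probability_integral_cst.
Qed.

Let k0 : 0 <= s ^- 2. Proof. by rewrite invr_ge0 sqr_ge0. Qed.
Let c0 : 0 < normal_peak s * expR (- P / s ^+ 2).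
Proof. by rewrite mulr_gt0 ?expR_gt0// normal_peak_gt0 ?gt_eqF. Qed.

Local Notation klf := (kl f s).

Let klf_ge0 x : (0 <= klf x)%E.
Proof.
exact: (kl_ge0 measurable_output_density s0 c0 k0 output_density_ge
  output_density_le integral_output_density).
Qed.

Let m_klf Y : measurable_fun setT Y -> measurable_fun [set: T] (fun z => klf (Y z)).
Proof.
exact: (measurable_kl measurable_output_density s0 c0 k0 output_density_ge
  output_density_le integral_output_density).
Qed.

Lemma information_ge0_measurable :
  (forall z, 0 <= klf (X z))%E /\ measurable_fun [set: T] (fun z => klf (X z)).
Proof. by split => //; exact: m_klf. Qed.

Let m_mix Y (g : R -> R) : measurable_fun setT Y -> measurable_fun setT g ->
  (forall w, 0 <= g w) ->
  measurable_fun [set: T] (fun z => \int[leb]_w (normal_pdf (Y z) s w * g w)%:E)%E.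
Proof.
move=> mY mg g0; apply: (measurable_fun_fubini_tonelli_F (m2 := leb)
  (fun p : T * R => (normal_pdf (Y p.1) s p.2 * g p.2)%:E)).
- apply/measurable_EFinP; apply: measurable_funM; last exact: measurableT_comp.
  by apply: measurable_normal_pdf_comp => //; exact: measurableT_comp.
- by move=> p; rewrite lee_fin mulr_ge0 ?normal_pdf_ge0.
Qed.

Let mix_ge0 Y (g : R -> R) z : (forall w, 0 <= g w) ->
  (0 <= \int[leb]_w (normal_pdf (Y z) s w * g w)%:E)%E.
Proof. by move=> g0; apply: integral_ge0 => w _; rewrite lee_fin mulr_ge0 ?normal_pdf_ge0. Qed.

Let mq : measurable_fun setT q. Proof. exact: measurable_normal_pdf. Qed.

Let m_ratio (g h : R -> R) : measurable_fun setT g -> measurable_fun setT h ->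
  (forall w, 0 < h w) -> measurable_fun setT (fun w => g w / h w).
Proof.
move=> mg mh h0; under eq_fun do rewrite -(lnK (h0 _)) -expRN.
apply: measurable_funM => //; apply: measurableT_comp => //.
by apply: measurableT_comp => //; exact: measurableT_comp.
Qed.

Let L := ln (S / s ^+ 2) / 2.
Let L0 : 0 <= L.
Proof.
rewrite divr_ge0// ln_ge0// ler_pdivlMr ?exprn_gt0// mul1r /S lerDl; exact: ltW.
Qed.

(** After the swap the output density cancels the denominator and only the total mass of [q]
    remains. *)
Let int1 : (\int[mu]_z \int[leb]_w (normal_pdf (X z) s w * (q w / f w))%:E = 1)%E.
Proof.
rewrite normal_mixture_swap//.
- rewrite -(integral_normal_pdf 0 (Num.sqrt S)); apply: eq_integral => w _.
  by rewrite -output_densityE -EFinM mulrCA divff ?mulr1// gt_eqF// output_density_gt0.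
- by apply: m_ratio => //; [exact: measurable_output_density|exact: output_density_gt0].
- by move=> w; rewrite divr_ge0 ?ltW// output_density_gt0.
Qed.

Lemma information_le : (\int[mu]_z klf (X z) <= L%:E)%E.
Proof.
have fq0 w : 0 <= q w / f w by rewrite divr_ge0 ?ltW// output_density_gt0.
have mfq : measurable_fun setT (fun w => q w / f w).
  by apply: m_ratio => //; [exact: measurable_output_density|exact: output_density_gt0].
have a0 : 0 <= L + s ^+ 2 / (2 * S).
  by rewrite addr_ge0// divr_ge0 ?sqr_ge0// mulr_ge0// ltW.
have b0 : 0 <= 1 / (2 * S) by rewrite divr_ge0// mulr_ge0// ltW.
have mb : measurable_fun [set: T] (fun z => (1 / (2 * S))%:E * (X z ^+ 2)%:E)%E.
  exact: measurable_funeM.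
have b0' z : (0 <= (1 / (2 * S))%:E * (X z ^+ 2)%:E)%E.
  by rewrite -EFinM lee_fin (mulr_ge0 b0 (sqr_ge0 _)).
(* Adding 1/2 to both sides of [kl_le] removes the constant [- 1 / 2], so both sides are integrals
   of nonnegative functions. *)
have : (\int[mu]_z (klf (X z) + (3 / 2)%:E) <=
  \int[mu]_z (((L + s ^+ 2 / (2 * S))%:E + (1 / (2 * S))%:E * (X z ^+ 2)%:E) +
     \int[leb]_w (normal_pdf (X z) s w * (q w / f w))%:E))%E.
  apply: ge0_le_integral => //.
  - by move=> z _; rewrite adde_ge0// lee_fin.
  - by apply: emeasurable_funD => //; exact: m_klf.
  - by apply: emeasurable_funD; [exact: emeasurable_funD|exact: m_mix].
  move=> z _.
  have := kl_le measurable_output_density s0 c0 k0 output_density_ge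
    output_density_le S0 (X z).
  rewrite -/q -/L -EFinM -EFinD; move: (kl _ _ _) (integral _ _ _) => K H.
  move=> /(leeD2r (1 / 2)%:E); rewrite -addeA -EFinD addeAC -EFinD.
  rewrite (_ : 1 + 1 / 2 = 3 / 2 :> R); last by lra.
  rewrite (_ : L + (s ^+ 2 + X z ^+ 2) / (2 * S) - 1 / 2 + 1 / 2 =
    L + s ^+ 2 / (2 * S) + 1 / (2 * S) * X z ^+ 2)//.
  by field; rewrite gt_eqF.
rewrite ge0_integralD//; last exact: m_klf.
rewrite (ge0_integral_affine a0 b0 mX2 _ (m_mix mX mfq fq0)
  (fun z => mix_ge0 X z fq0)); last by move=> z; rewrite lee_fin sqr_ge0.
rewrite probability_integral_cst int1.
move=> H; rewrite -(@leeD2rE _ (3 / 2)%:E)//.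
apply: (le_trans H); apply: (@le_trans _ _
   ((L + s ^+ 2 / (2 * S))%:E + (1 / (2 * S))%:E * P%:E + 1%:E)%E).
  by rewrite leeD2r// leeD2l// lee_wpmul2l ?lee_fin.
rewrite -EFinM -!EFinD lee_fin le_eqVlt; apply/orP; left; apply/eqP.
by rewrite /S; field; rewrite -/S gt_eqF.
Qed.

(** [Y] plays the ideal Gaussian input coupled with [X]. [D] bounds both errors in [kl_ge]: the
    squared distance, weighted by [1 / (2 * s ^+ 2)], and the lost power, weighted by [1 / (2 * S)].
    As [S] exceeds [s ^+ 2], they total at most [D / s ^+ 2]. *)
Lemma information_ge Y (D : T -> R) (delta : R) :
  measurable_fun setT Y -> measurable_fun setT D ->
  (\int[mu]_z (Y z ^+ 2)%:E = P%:E)%E ->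
  (forall w, \int[mu]_z (normal_pdf (Y z) s w)%:E = (q w)%:E)%E ->
  (forall z, (Y z - X z) ^+ 2 <= D z) ->
  (forall z, Y z ^+ 2 - X z ^+ 2 <= D z) ->
  (\int[mu]_z (D z)%:E <= delta%:E)%E ->
  (L%:E <= \int[mu]_z klf (X z) + (delta / s ^+ 2)%:E)%E.
Proof.
move=> mY mD Y2 Yq DX DX2 Ddelta.
have D0 z : 0 <= D z by apply: le_trans (DX z); exact: sqr_ge0.
have mf := measurable_output_density.
have fq0 w : 0 <= f w / q w by rewrite divr_ge0 ?ltW// output_density_gt0.
have mfq : measurable_fun setT (fun w => f w / q w) by exact: m_ratio.
have a0 : 0 <= L + 1 + s ^+ 2 / (2 * S).
  by rewrite addr_ge0 ?divr_ge0 ?sqr_ge0// ?addr_ge0// mulr_ge0// ltW.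
have b0 : 0 <= 1 / (2 * S) by rewrite divr_ge0// mulr_ge0// ltW.
have mY2 : measurable_fun [set: T] (fun z => (Y z ^+ 2)%:E).
  by apply/measurable_EFinP; exact: measurable_funX.
have mb : measurable_fun [set: T] (fun z => (1 / (2 * S))%:E * (Y z ^+ 2)%:E)%E.
  exact: measurable_funeM.
have mDE : measurable_fun [set: T] (fun z => (D z)%:E) by exact/measurable_EFinP.
have mc : measurable_fun [set: T] (fun z => (s ^- 2)%:E * (D z)%:E)%E.
  exact: measurable_funeM.
have b0' z : (0 <= (1 / (2 * S))%:E * (Y z ^+ 2)%:E)%E.
  by rewrite -EFinM lee_fin (mulr_ge0 b0 (sqr_ge0 _)).
have c0' z : (0 <= (s ^- 2)%:E * (D z)%:E)%E.
  by rewrite -EFinM lee_fin mulr_ge0.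
pose H z := (klf (X z) + \int[leb]_w (normal_pdf (Y z) s w * (f w / q w))%:E)%E.
have H0 z : (0 <= H z)%E by apply: adde_ge0 => //; exact: mix_ge0.
have mH : measurable_fun setT H.
  by apply: emeasurable_funD; [exact: m_klf|exact: m_mix].
(* The errors move to the right, which leaves nonnegative integrands on both sides. *)
have : (\int[mu]_z ((L + 1 + s ^+ 2 / (2 * S))%:E + (1 / (2 * S))%:E * (Y z ^+ 2)%:E) <=
  \int[mu]_z ((1 / 2)%:E + (s ^- 2)%:E * (D z)%:E + H z))%E.
  apply: ge0_le_integral => //.
  - by move=> z _; rewrite adde_ge0// lee_fin.
  - exact: emeasurable_funD.
  - by apply: emeasurable_funD => //; exact: emeasurable_funD.
  move=> z _.
  have klH := kl_ge measurable_output_density s0 c0 k0 output_density_ge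
    output_density_le S0 (X z) (Y z).
  rewrite -!EFinM -!EFinD.
  apply: le_trans (leeD2l _ klH); rewrite -EFinD lee_fin -/L.
  have h1 : 1 / (2 * S) <= s ^- 2 / 2.
    rewrite mul1r invfM mulrC ler_pM2r// lef_pV2 ?posrE ?exprn_gt0//.
    by rewrite /S lerDl ltW.
  have h2 : (X z - Y z) ^+ 2 / (2 * s ^+ 2) <= s ^- 2 / 2 * D z.
    rewrite [leRHS](_ : _ = D z / (2 * s ^+ 2)); last by field; rewrite gt_eqF.
    rewrite ler_pM2r ?invr_gt0 ?mulr_gt0 ?exprn_gt0//.
    by rewrite -sqrrN opprB.
  have h3 : 1 / (2 * S) * (Y z ^+ 2 - X z ^+ 2) <= s ^- 2 / 2 * D z.
    apply: (@le_trans _ _ (1 / (2 * S) * D z)); first by rewrite ler_wpM2l.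
    by rewrite ler_wpM2r.
  have -> : (s ^+ 2 + X z ^+ 2) / (2 * S) = s ^+ 2 / (2 * S) + 1 / (2 * S) * X z ^+ 2.
    by field; rewrite gt_eqF.
  move: h2 h3; set u := (X z - Y z) ^+ 2 / _; set v := s ^- 2; lra.
rewrite (ge0_integral_affine _ _ mDE _ mH H0)//.
rewrite /H (ge0_integralD mu measurableT (fun z _ => klf_ge0 _) (m_klf mX)
  (fun z _ => mix_ge0 Y z fq0) (m_mix mY mfq fq0)).
rewrite ge0_integralD// ?lee_fin//.
rewrite probability_integral_cst ge0_integralZl_EFin//; last first.
  by move=> z _; rewrite lee_fin sqr_ge0.
rewrite Y2 normal_mixture_swap//.
have -> : (\int[leb]_w (\int[mu]_z (normal_pdf (Y z) s w)%:E * (f w / q w)%:E) = 1)%E.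
  rewrite -integral_output_density; apply: eq_integral => w _.
  by rewrite Yq -EFinM mulrCA divff ?mulr1// gt_eqF.
move=> LI; rewrite -(@leeD2rE _ (3 / 2)%:E)//.
have -> : (L%:E + (3 / 2)%:E =
   (L + 1 + s ^+ 2 / (2 * S))%:E + (1 / (2 * S))%:E * P%:E)%E.
  by rewrite -EFinM -!EFinD; congr EFin; rewrite /S; field; rewrite -/S gt_eqF.
apply: (le_trans LI); move: (integral _ _ _) (integral _ _ _) Ddelta => I J Jd.
rewrite addeACA (addeC (1 / 2)%:E) addeACA -EFinD (_ : 1 / 2 + 1 = 3 / 2 :> R); last by lra.
by rewrite leeD2r// leeD2l// mulrC EFinM lee_wpmul2l// lee_fin.
Qed.

End channel.

(** Passes between the iterated integrals that define stationarity and the rate, and the joint law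
    to which the channel bounds apply. *)
Lemma integral_prod3 d1 d2 d3 (T1 : measurableType d1) (T2 : measurableType d2)
    (T3 : measurableType d3) (R : realType)
    (P1 : probability T1 R) (P2 : probability T2 R) (P3 : probability T3 R)
    (h : T1 * (T2 * T3) -> \bar R) :
  measurable_fun setT h -> (forall z, 0 <= h z)%E ->
  (\int[P1 \x (P2 \x P3)]_z h z =
   \int[P1]_a \int[P2]_b \int[P3]_c h (a, (b, c)))%E.
Proof.
move=> mh h0; apply: etrans.
  exact: (@fubini_tonelli1 _ _ _ _ _ P1 ((P2 \x P3)%E : probability (T2 * T3)%type R) h mh h0).
apply: eq_integral => a _; apply: (@fubini_tonelli1 _ _ _ _ _ P2 P3 (fun u => h (a, u))) => //.
exact: measurableT_comp.
Qed.

(** * Elementary bounds on the truncated input and the clipped buffer *)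

Section truncation.
Context {R : realType}.
Implicit Types (e y x t : R).

Lemma sqr_tg_input e y x : tg_input e y x ^+ 2 = minr (Num.sqrt (e + y)) `|x| ^+ 2.
Proof.
rewrite /tg_input exprMn; have [->|x0] := eqVneq x 0; last by rewrite sqr_sg x0 mul1r.
by rewrite sgr0 expr0n mul0r normr0 min_r ?sqrtr_ge0// expr0n.
Qed.

(** [u <= expR (t * u) / t] at [u = x ^+ 2 - (e + y)] replaces a positive part by an exponential,
    which factors over independent variables. *)
Lemma tg_input_defect e y x t : 0 < t ->
  x ^+ 2 - tg_input e y x ^+ 2 <= t^-1 * expR (- t * (e + y - x ^+ 2)).
Proof.
move=> t0; rewrite sqr_tg_input.
have D0 : 0 <= t^-1 * expR (- t * (e + y - x ^+ 2)) by rewrite mulr_ge0 ?invr_ge0 ?ltW ?expR_gt0.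
rewrite minEle; case: ifPn => _; last by rewrite real_normK ?num_real// subrr.
(* [Num.sqrt] is 0 on negative arguments, hence an inequality that covers both signs of [e + y]. *)
have sq : e + y <= Num.sqrt (e + y) ^+ 2.
  have [ey|ey] := leP 0 (e + y); first by rewrite sqr_sqrtr.
  by rewrite (le_trans (ltW ey))// sqr_ge0.
rewrite ler_pdivlMl//; apply: le_trans (expR_ge1Dx _).
have : t * (x ^+ 2 - Num.sqrt (e + y) ^+ 2) <= t * (x ^+ 2 - (e + y)).
  by rewrite ler_pM2l// lerB.
by lra.
Qed.

Lemma sqr_tg_input_le e y x : tg_input e y x ^+ 2 <= x ^+ 2.
Proof.
rewrite sqr_tg_input -[leRHS]real_normK ?num_real//.
by rewrite ler_sqr ?nnegrE ?le_min ?sqrtr_ge0 ?normr_ge0 ?ge_min ?lexx ?orbT.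
Qed.

(** The input keeps the sign of [x], so the distance is [|x| - m] with [0 <= m <= |x|], and
    [(a - b) ^+ 2 <= a ^+ 2 - b ^+ 2] whenever [0 <= b <= a]. *)
Lemma sqr_tg_input_sub e y x :
  (x - tg_input e y x) ^+ 2 <= x ^+ 2 - tg_input e y x ^+ 2.
Proof.
rewrite sqr_tg_input /tg_input; set m := minr _ _.
have m0 : 0 <= m by rewrite le_min sqrtr_ge0 normr_ge0.
have mx : m <= `|x| by rewrite ge_min lexx orbT.
have -> : (x - Num.sg x * m) ^+ 2 = (`|x| - m) ^+ 2.
  rewrite {1}[x]numEsg -mulrBr exprMn; have [x0|x0] := eqVneq x 0; last first.
    by rewrite sqr_sg x0 mul1r.
  have -> : m = 0 by apply/eqP; rewrite eq_le m0 (le_trans mx)// x0 normr0.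
  by rewrite x0 normr0 subr0 expr0n mulr0.
rewrite -(real_normK (num_real x)); nra.
Qed.

(** Clamping to an interval avoids the sign function, so measurability follows from that of [maxr]
    and [minr]. *)
Lemma tg_inputE e y x :
  tg_input e y x = maxr (- Num.sqrt (e + y)) (minr (Num.sqrt (e + y)) x).
Proof.
rewrite /tg_input; have := sqrtr_ge0 (e + y); set m := Num.sqrt _ => m0.
have [x0|x0|->] := ltrgt0P x.
- by rewrite gtr0_sg// mul1r max_r// le_min; apply/andP; split; lra.
- rewrite ltr0_sg// mulN1r [minr m x]min_r; last by lra.
  by rewrite oppr_min opprK.
- by rewrite sgr0 mul0r min_r// max_r//; lra.
Qed.

Lemma measurable_tg_input d (T : measurableType d) (e y x : T -> R) :
  measurable_fun setT e -> measurable_fun setT y -> measurable_fun setT x ->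
  measurable_fun setT (fun z => tg_input (e z) (y z) (x z)).
Proof.
move=> me my mx; under eq_fun do rewrite tg_inputE.
have ms : measurable_fun setT (fun z => Num.sqrt (e z + y z)).
  apply: measurableT_comp; last exact: measurable_funD.
  apply: continuous_measurable_fun; exact: sqrt_continuous.
by apply: measurable_maxr; [exact: measurableT_comp|exact: measurable_minr].
Qed.

Lemma measurable_clip d (T : measurableType d) (Gamma : R) (g : T -> R) :
  measurable_fun setT g -> measurable_fun setT (fun z => clip Gamma (g z)).
Proof.
move=> mg; apply: measurable_minr; first exact: measurable_cst.
by apply: measurable_maxr => //; exact: measurable_cst.
Qed.

(** The clipped value is either [Gamma] or at least [x]; the sum covers both cases and yields the
    recursion for the stationary exponential moment. *)
Lemma expR_clip_le (Gamma t x : R) : 0 < t -> 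
  expR (- t * clip Gamma x) <= expR (- t * Gamma) + expR (- t * x).
Proof.
move=> t0; rewrite /clip minEle; case: ifPn => _; first by rewrite lerDl expR_ge0.
apply: (@le_trans _ _ (expR (- t * x))); last by rewrite lerDr expR_ge0.
by rewrite ler_expR !mulNr lerN2 ler_pM2l// le_max lexx orbT.
Qed.

(** Through [expR (- x) <= (1 + x)^-1] and [(1 - x + x ^+ 2) * (1 + x) = 1 + x ^+ 3]. *)
Lemma expRN_le_quadratic x : 0 <= x -> expR (- x) <= 1 - x + x ^+ 2.
Proof.
move=> x0; rewrite expRN; apply: (@le_trans _ _ (1 + x)^-1).
  by rewrite lef_pV2 ?posrE ?expR_gt0 ?expR_ge1Dx// ltr_wpDr.
have x1 : 0 < 1 + x by rewrite ltr_wpDr.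
rewrite -[leLHS]mul1r ler_pdivrMr//.
have : 0 <= x ^+ 3 by rewrite exprn_ge0.
by nra.
Qed.

End truncation.

(** * Laplace transform of the harvested energy *)

Section nonneg_law.
Context {R : realType} (nu : probability R R) (mY : R).
Hypothesis nu_nonneg : nu [set y : R | 0 <= y] = 1%E.
Hypothesis nu_2mom : (\int[nu]_y (y ^+ 2)%:E < +oo)%E.
Hypothesis nu_mean : (\int[nu]_y y%:E)%E = mY%:E.

Let mge0 : measurable [set y : R | 0 <= y].
Proof.
rewrite (_ : [set y : R | 0 <= y] = `[0, +oo[%classic); first exact: measurable_itv.
by apply/seteqP; split => y /=; rewrite in_itv/= andbT.
Qed.

Lemma ae_nonneg : {ae nu, forall y, 0 <= y}.
Proof.
exists (~` [set y : R | 0 <= y]); split => //; first exact: measurableC.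
by rewrite probability_setC// nu_nonneg subee.
Qed.

Lemma laplace_le (t : R) : 0 <= t ->
  (\int[nu]_y (expR (- t * y))%:E + (t * mY)%:E <=
   1 + (t ^+ 2)%:E * \int[nu]_y (y ^+ 2)%:E)%E.
Proof.
move=> t0.
have mid : measurable_fun [set: R] (fun y : R => y%:E) by exact/measurable_EFinP.
have mabs : measurable_fun [set: R] (fun y : R => `|y|%:E).
  by apply/measurable_EFinP; exact: normr_measurable.
have mexp : measurable_fun [set: R] (fun y : R => (expR (- t * y))%:E).
  by apply/measurable_EFinP; apply: measurableT_comp => //; exact: measurable_funM.
have msq : measurable_fun [set: R] (fun y : R => (y ^+ 2)%:E).
  by apply/measurable_EFinP; exact: measurable_funX.
(* [y] is traded for its absolute value, equal almost everywhere and nonnegative everywhere. *)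
have nu_abs : (\int[nu]_y `|y|%:E)%E = mY%:E.
  rewrite -nu_mean; apply: ae_eq_integral => //.
  by apply: filterS ae_nonneg => y y0 _; rewrite ger0_norm.
have mtabs := measurable_funeM t%:E mabs; have mtsq := measurable_funeM (t ^+ 2)%:E msq.
have tabs0 y : (0 <= t%:E * `|y|%:E)%E by rewrite mule_ge0// lee_fin.
have tsq0 y : (0 <= (t ^+ 2)%:E * (y ^+ 2)%:E)%E by rewrite -EFinM lee_fin mulr_ge0// sqr_ge0.
have e0 y : (0 <= (expR (- t * y))%:E)%E by rewrite lee_fin expR_ge0.
have : (\int[nu]_y ((expR (- t * y))%:E + t%:E * `|y|%:E) <=
    \int[nu]_y (1%:E + (t ^+ 2)%:E * (y ^+ 2)%:E))%E.
  apply: ae_ge0_le_integral => //.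
  - by move=> y _; exact: adde_ge0.
  - exact: emeasurable_funD.
  - by move=> y _; rewrite adde_ge0// lee_fin.
  - exact: emeasurable_funD.
  apply: filterS ae_nonneg => y y0 _; rewrite -!EFinM -!EFinD lee_fin ger0_norm//.
  have := expRN_le_quadratic (mulr_ge0 t0 y0).
  by rewrite mulNr exprMn; lra.
rewrite ge0_integralD// [leRHS]ge0_integralD// ?lee_fin//.
rewrite probability_integral_cst !ge0_integralZl_EFin ?sqr_ge0//.
  by rewrite nu_abs EFinM.
by move=> y _; rewrite lee_fin sqr_ge0.
Qed.


Lemma second_moment_fin : exists2 K : R, 0 <= K & (\int[nu]_y (y ^+ 2)%:E = K%:E)%E.
Proof.
have K0 : (0 <= \int[nu]_y (y ^+ 2)%:E)%E by apply: integral_ge0 => y _; rewrite lee_fin sqr_ge0.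
exists (fine (\int[nu]_y (y ^+ 2)%:E)%E); first exact: fine_ge0.
by rewrite fineK// ge0_fin_numE.
Qed.

End nonneg_law.

(** * Stationary buffer: exponential drift and mean truncation defect *)

Section stationary_chain.
Context {R : realType} (nu : probability R R) (mY : R).
Hypothesis nu_nonneg : nu [set y : R | 0 <= y] = 1%E.
Hypothesis nu_2mom : (\int[nu]_y (y ^+ 2)%:E < +oo)%E.
Hypothesis nu_mean : (\int[nu]_y y%:E)%E = mY%:E.

(** The product is the mean of [expR (- t * (Y - X' ^+ 2))]. The Gaussian factor is [(1 - a)^-1] and
    the other is at most [1 - t * mY + t ^+ 2 * K], so it suffices that [a < t * (mY - t * K)]. To
    first order [t = a / P], and [mY > P] leaves room. *)
Lemma negative_drift eps : 0 < eps < mY ->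
  exists t rho : R, [/\ 0 < t, rho < 1 &
    (\int[nu]_y (expR (- t * y))%:E *
     \int[normal_prob 0 (Num.sqrt (mY - eps))]_x (expR (t * x ^+ 2))%:E <= rho%:E)%E].
Proof.
move=> /andP[eps0 epsY].
have [K K0 EK] := second_moment_fin nu_2mom.
pose P := mY - eps; have P0 : 0 < P by rewrite subr_gt0.
have mY0 : 0 < mY by apply: lt_trans epsY.
pose s := Num.sqrt P; have s0 : 0 < s by rewrite sqrtr_gt0.
have s2 : s ^+ 2 = P by rewrite sqr_sqrtr// ltW.
(* Chosen so that the second-order terms, [a * mY + 2 * a * (K / P)], equal [eps], half of the
   available margin [2 * eps]. *)
pose a := eps / (mY + 2 * K / P).
have KP0 : 0 <= 2 * K / P by rewrite divr_ge0 ?mulr_ge0// ltW.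
have b0 : 0 < mY + 2 * K / P by rewrite ltr_pwDl.
have a0 : 0 < a by rewrite divr_gt0.
have a1 : a < 1 by rewrite ltr_pdivrMr// mul1r (lt_le_trans epsY)// lerDl.
have a1' : 0 < 1 - a by rewrite subr_gt0.
pose r := s / (1 - a); have r0 : 0 < r by rewrite divr_gt0.
pose t := (s ^- 2 - r ^- 2) / 2.
have tE : t = a * (2 - a) / (2 * P).
  by rewrite /t /r expr_div_n s2 invf_div; field; rewrite gt_eqF.
have a2 : 0 < 2 - a by lra.
have t0 : 0 < t by rewrite tE (divr_gt0 (mulr_gt0 a0 a2))// (mulr_gt0 _ P0).
exists t, ((1 - t * mY + t ^+ 2 * K) / (1 - a)); split => //.
  rewrite ltr_pdivrMr// mul1r.
  have aE : a * mY + 2 * a * (K / P) = eps by rewrite /a; field; rewrite !gt_eqF//; nra.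
  have tP : t <= a / P.
    rewrite tE invfM mulrA ler_pM2r ?invr_gt0// ler_pdivrMr// ler_pM2l//; lra.
  have tK : t * K <= a * (K / P) by have := ler_wpM2r K0 tP; rewrite [X in _ <= X]mulrAC -mulrA.
  have : a < t * (mY - t * K).
    have -> : t * (mY - t * K) = a * ((2 - a) * (mY - t * K) / (2 * P)).
      by rewrite [X in X * _]tE; field; rewrite gt_eqF.
    rewrite ltr_pMr// ltr_pdivlMr ?mulr_gt0// mul1r /P.
    have : 0 <= a * (t * K) := mulr_ge0 (ltW a0) (mulr_ge0 (ltW t0) K0).
    nra.
  nra.
have -> : (\int[normal_prob 0 (Num.sqrt (mY - eps))]_x (expR (t * x ^+ 2))%:E =
   ((1 - a)^-1)%:E)%E.
  by rewrite normal_prob_square_tilt// /r mulrAC divff ?mul1r// gt_eqF.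
rewrite EFinM; apply: lee_wpmul2r; first by rewrite lee_fin invr_ge0 ltW.
have := laplace_le nu_nonneg nu_mean (ltW t0); rewrite EK -EFinM -EFinD -leeBrDr//.
by rewrite -EFinB (_ : 1 + t ^+ 2 * K - t * mY = 1 - t * mY + t ^+ 2 * K) //; ring.
Qed.

(* Joint law of (E, Y, X'). [normal_prob] lives on [measurableTypeR R], whose
   measurable structure is convertible to that of [R] but not syntactically equal. *)
Definition harvest_law (pi : probability R R) (s : R) :
    probability (R * (R * measurableTypeR R))%type R :=
  (pi \x (nu \x normal_prob 0 s))%E.

Variables (eps Gamma : R) (pi : probability R R).
Hypothesis epsI : 0 < eps < mY.
Hypothesis Gamma0 : 0 < Gamma.
Hypothesis pi_stat : stationary nu mY eps Gamma pi.
Let s := Num.sqrt (mY - eps).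
Let mu := harvest_law pi s.

Let next (z : R * (R * measurableTypeR R)) : R :=
  clip Gamma (z.1 + (z.2.1 - z.2.2 ^+ 2)).

Lemma measurable_step :
  measurable_fun setT (fun z : R * (R * measurableTypeR R) =>
    z.1 + (z.2.1 - (z.2.2 : R) ^+ 2)).
Proof.
apply: measurable_funD => //; apply: measurable_funB; first exact: measurableT_comp.
by apply: measurable_funX; exact: measurableT_comp.
Qed.

Let mnext : measurable_fun setT next.
Proof. by apply: measurable_clip; exact: measurable_step. Qed.

(** Stationarity, read through Tonelli, says that [pi] is the image of [mu] under [next]; equal
    measures have equal integrals. *)
Lemma integral_stationary (h : R -> \bar R) :
  measurable_fun setT h -> (forall x, 0 <= h x)%E ->
  (\int[pi]_e h e = \int[mu]_z h (next z))%E.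
Proof.
move=> mh h0.
transitivity (\int[pushforward mu next]_e h e)%E; last first.
  by rewrite ge0_integral_pushforward// preimage_setT.
apply: eq_measure_integral => A mA _.
apply: (etrans (pi_stat mA)); rewrite /pushforward.
have mA' : measurable (next @^-1` A) by rewrite -[X in measurable X]setTI; exact: mnext.
transitivity (\int[mu]_z (\1_(next @^-1` A) z)%:E)%E; last first.
  by rewrite integral_indic; [rewrite setIT|exact: measurableT|].
have mI : measurable_fun setT (fun z => (\1_(next @^-1` A) z : R)%:E).
  exact/measurable_EFinP/measurable_indic.
by apply/esym/(integral_prod3 pi nu (normal_prob 0 s) mI) => z; rewrite lee_fin.
Qed.

Lemma stationary_defect (t rho : R) : 0 < t -> rho < 1 ->
  (\int[nu]_y (expR (- t * y))%:E *
     \int[normal_prob 0 s]_x (expR (t * x ^+ 2))%:E <= rho%:E)%E ->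
  (\int[mu]_z (t^-1 * expR (- t * (z.1 + z.2.1 - z.2.2 ^+ 2)))%:E <=
    (expR (- t * Gamma) / (t * (1 - rho)))%:E)%E.
Proof.
move=> t0 rho1 drift.
pose F (z : R * (R * measurableTypeR R)) := expR (- t * (z.1 + (z.2.1 - z.2.2 ^+ 2))).
have F0 z : (0 <= (F z)%:E)%E by rewrite lee_fin expR_ge0.
have mF : measurable_fun setT (fun z => (F z)%:E).
  apply/measurable_EFinP; apply: measurableT_comp => //.
  by apply: measurable_funM => //; exact: measurable_step.
have mexpN : measurable_fun [set: R] (fun y : R => (expR (- t * y))%:E).
  by apply/measurable_EFinP; apply: measurableT_comp => //; exact: measurable_funM.
have mexp2 : measurable_fun [set: measurableTypeR R] (fun x : R => (expR (t * x ^+ 2))%:E).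
  apply/measurable_EFinP; apply: measurableT_comp => //.
  by apply: measurable_funM => //; exact: measurable_funX.
have e0 (x : R) : (0 <= (expR x)%:E)%E by rewrite lee_fin expR_ge0.
set A := (\int[nu]_y _)%E in drift; set B := (\int[normal_prob _ _]_x _)%E in drift.
have A0 : (0 <= A)%E by exact: integral_ge0.
have B0 : (0 <= B)%E by exact: integral_ge0.
pose m := (\int[pi]_e (expR (- t * e))%:E)%E.
have m0 : (0 <= m)%E by exact: integral_ge0.
have EF : (\int[mu]_z (F z)%:E = m * (A * B))%E.
  rewrite integral_prod3//.
  transitivity (\int[pi]_e ((expR (- t * e))%:E * (A * B)))%E; last first.
    by rewrite ge0_integralZr// mule_ge0.
  apply: eq_integral => e _.
  transitivity (\int[nu]_y ((expR (- t * e))%:E * ((expR (- t * y))%:E * B)))%E; last first.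
    rewrite ge0_integralZl//; first by rewrite ge0_integralZr.
    - by apply: emeasurable_funM.
    - by move=> y _; rewrite mule_ge0.
  apply: eq_integral => y _.
  rewrite muleA -ge0_integralZl//.
  apply: eq_integral => x _; rewrite -!EFinM -!expRD; congr (expR _)%:E.
  by rewrite /F /=; ring.
have m_next : m = (\int[mu]_z (expR (- t * next z))%:E)%E.
  by rewrite /m (integral_stationary (h := fun e => (expR (- t * e))%:E)).
have mFn : measurable_fun setT (fun z => (expR (- t * next z))%:E).
  exact: (measurableT_comp mexpN mnext).
(* A clipped level is nonnegative, so stationarity bounds [m] by 1; its finiteness allows [m * rho]
   to be subtracted below. *)
have m1 : (m <= 1)%E.
  rewrite m_next -(probability_integral_cst mu 1); apply: ge0_le_integral => //.
  move=> z _; rewrite lee_fin -expR0 ler_expR mulNr oppr_le0; apply: mulr_ge0; first exact: ltW.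
  by rewrite /next /clip le_min (ltW Gamma0) le_max lexx.
have [M M0 mE] : exists2 M : R, 0 <= M & m = M%:E.
  exists (fine m); first exact: fine_ge0.
  by rewrite fineK// ge0_fin_numE// (le_lt_trans m1)// ltry.
have mrec : (m <= (expR (- t * Gamma))%:E + m * (A * B))%E.
  rewrite -EF {1}m_next -(probability_integral_cst mu (expR (- t * Gamma))).
  rewrite -ge0_integralD//; apply: ge0_le_integral => //.
  - exact: emeasurable_funD.
  - by move=> z _; rewrite -EFinD lee_fin; exact: expR_clip_le.
have {}mrec : M * (1 - rho) <= expR (- t * Gamma).
  have : (m <= (expR (- t * Gamma))%:E + m * rho%:E)%E.
    by apply: (le_trans mrec); rewrite leeD2l// lee_wpmul2l.
  by rewrite mE -EFinM -EFinD lee_fin; lra.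
have -> : (\int[mu]_z (t^-1 * expR (- t * (z.1 + z.2.1 - z.2.2 ^+ 2)))%:E =
    t^-1%:E * (m * (A * B)))%E.
  rewrite -EF -(ge0_integralZl_EFin mu measurableT (fun z _ => F0 z) mF); last first.
    by rewrite invr_ge0 ltW.
  by apply: eq_integral => z _; rewrite -EFinM /F addrA.
apply: (@le_trans _ _ (t^-1%:E * (m * rho%:E))%E).
  by rewrite lee_wpmul2l ?lee_fin ?invr_ge0 ?(ltW t0)// lee_wpmul2l.
rewrite mE -!EFinM lee_fin invfM [leRHS]mulrCA ler_pM2l ?invr_gt0//.
have r1 : 0 < 1 - rho by rewrite subr_gt0.
rewrite ler_pdivlMr//; apply: le_trans mrec; rewrite ler_pM2r//.
by rewrite ler_piMr//; exact: ltW.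
Qed.

End stationary_chain.

(** * The rate as an integral over the joint law, and its two bounds *)

Section rate.
Context {R : realType} (nu : probability R R) (mY sigma eps : R).
Hypotheses (sigma0 : 0 < sigma) (epsI : 0 < eps < mY).
Variable pi : probability R R.

Let P := mY - eps.
Let P0 : 0 < P. Proof. by rewrite subr_gt0; case/andP: epsI. Qed.
Let s := Num.sqrt P.
Let s0 : 0 < s. Proof. by rewrite sqrtr_gt0. Qed.
Let s2 : s ^+ 2 = P. Proof. by rewrite sqr_sqrtr// ltW. Qed.
Let mu := harvest_law nu pi s.
Let T := (R * (R * measurableTypeR R))%type.
Let X (z : T) : R := tg_input z.1 z.2.1 z.2.2.
Let X' (z : T) : R := z.2.2.

Let mX' : measurable_fun setT X'. Proof. exact: measurableT_comp. Qed.

Let mX : measurable_fun setT X.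
Proof. by apply: measurable_tg_input => //; exact: measurableT_comp. Qed.

Lemma integral_harvest_law_gauss (h : R -> \bar R) :
  measurable_fun setT h -> (forall x, 0 <= h x)%E ->
  (\int[mu]_z h (X' z) = \int[normal_prob 0 s]_x h x)%E.
Proof.
move=> mh h0; have mhX : measurable_fun setT (fun z => h (X' z)).
  exact: (measurableT_comp mh mX').
apply: (etrans (integral_prod3 pi nu (normal_prob 0 s) mhX (fun z => h0 (X' z)))).
have cstE (Q : probability R R) (c : \bar R) : (\int[Q]__ c = c)%E.
  by rewrite integral_cst// -[RHS]mule1; congr (_ * _)%E; exact: probability_setT.
apply: etrans (cstE pi _); apply: eq_integral => a _.
exact: (cstE nu (\int[normal_prob 0 s]_x h x)%E).
Qed.

Let msq : measurable_fun [set: R] (fun x : R => (x ^+ 2)%:E).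
Proof. exact/measurable_EFinP/measurable_funX. Qed.

Let intX'2 : (\int[mu]_z (X' z ^+ 2)%:E = P%:E)%E.
Proof.
rewrite (integral_harvest_law_gauss msq); last by move=> x; rewrite lee_fin sqr_ge0.
by rewrite normal_prob_square// s2.
Qed.

Let intX2 : (\int[mu]_z (X z ^+ 2)%:E <= P%:E)%E.
Proof.
rewrite -intX'2; apply: ge0_le_integral => //.
- by move=> z _; rewrite lee_fin sqr_ge0.
- exact/measurable_EFinP/measurable_funX.
- exact/measurable_EFinP/measurable_funX.
- by move=> z _; rewrite lee_fin sqr_tg_input_le.
Qed.

Lemma W_densityE : W_density nu mY sigma eps pi = output_density mu X sigma.
Proof.
apply/funext => w; rewrite /W_density /output_density; congr fine.
have mf := measurable_EFin_normal_pdf_comp sigma0 mX (measurable_cst w).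
by apply/esym/(integral_prod3 pi nu (normal_prob 0 s) mf) => z; rewrite lee_fin normal_pdf_ge0.
Qed.

Lemma rateE : (rate nu mY sigma eps pi =
  \int[mu]_z kl (output_density mu X sigma) sigma (X z))%E.
Proof.
rewrite /rate W_densityE.
have [k0 mk] := information_ge0_measurable mX sigma0 P0 intX2.
by apply/esym/(integral_prod3 pi nu (normal_prob 0 s) mk).
Qed.

Let ratioE : (sigma ^+ 2 + P) / sigma ^+ 2 = 1 + P / sigma ^+ 2.
Proof. by rewrite mulrDl divff// expf_neq0// gt_eqF. Qed.

Lemma rate_le : (rate nu mY sigma eps pi <= (ln (1 + P / sigma ^+ 2) / 2)%:E)%E.
Proof. by rewrite rateE -ratioE; exact: information_le. Qed.

(** [information_ge] with X' as the ideal input and, for [D], the exponential bound of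
    [tg_input_defect], which dominates both errors. *)
Lemma rate_ge t delta : 0 < t ->
  (\int[mu]_z (t^-1 * expR (- t * (z.1 + z.2.1 - z.2.2 ^+ 2)))%:E <= delta%:E)%E ->
  ((ln (1 + P / sigma ^+ 2) / 2 - delta / sigma ^+ 2)%:E <= rate nu mY sigma eps pi)%E.
Proof.
move=> t0 Hd; rewrite EFinB leeBlDr// rateE -ratioE.
pose D (z : T) : R := t^-1 * expR (- t * (z.1 + z.2.1 - z.2.2 ^+ 2)).
have mD : measurable_fun setT D.
  apply: measurable_funM => //; apply: measurableT_comp => //.
  apply: measurable_funM => //; apply: measurable_funB.
    by apply: measurable_funD => //; exact: measurableT_comp.
  exact: measurable_funX.
apply: (information_ge mX sigma0 P0 intX2 mX' mD intX'2) => //.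
- move=> w; have mw := measurable_EFin_normal_pdf_comp sigma0 (@measurable_id _ R setT) (measurable_cst w).
  rewrite (integral_harvest_law_gauss mw); last by move=> x; rewrite lee_fin normal_pdf_ge0.
  by rewrite normal_prob_conv// s2 addrC.
- by move=> z; apply: le_trans (sqr_tg_input_sub _ _ _) (tg_input_defect _ _ _ t0).
- by move=> z; exact: tg_input_defect.
Qed.

End rate.

(** * Asymptotics in the buffer size *)

(** [t] and [C] come from the drift alone, hence are common to all capacities and stationary
    laws. *)
Lemma rate_ge_exp (R : realType) (nu : probability R R) (mY sigma eps : R) :
  nu [set y : R | 0 <= y] = 1%E ->
  (\int[nu]_y (y ^+ 2)%:E < +oo)%E ->
  (\int[nu]_y y%:E)%E = mY%:E -> 0 < sigma -> 0 < eps < mY ->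
  exists t C : R, 0 < t /\ forall (Gamma : R) (pi : probability R R),
    0 < Gamma -> stationary nu mY eps Gamma pi ->
    ((ln (1 + (mY - eps) / sigma ^+ 2) / 2 - C * expR (- t * Gamma))%:E <=
     rate nu mY sigma eps pi)%E.
Proof.
move=> nu0 nu2 nu1 sigma0 epsI.
have [t [rho [t0 rho1 drift]]] := negative_drift nu0 nu2 nu1 epsI.
exists t, ((t * (1 - rho))^-1 / sigma ^+ 2); split => // Gamma pi Gamma0 pi_stat.
have := rate_ge sigma0 epsI t0 (stationary_defect Gamma0 pi_stat t0 rho1 drift).
by rewrite [X in _ - X / _]mulrC mulrAC.
Qed.

(** Beyond [|C| / (e * t)], already [t * G] exceeds [|C| / e], and [expR (t * G) >= 1 + t * G]. *)
Lemma near_pinfty_exp_lt (R : realType) (t C e : R) : 0 < t -> 0 < e ->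
  \forall G \near pinfty_nbhs R, 0 < G /\ C * expR (- t * G) < e.
Proof.
move=> t0 e0; exists (Num.max 0 (`|C| / (e * t))); split; first exact: num_real.
move=> G; rewrite gt_max => /andP[G0 GC]; split => //.
apply: le_lt_trans (_ : `|C| * expR (- t * G) < e).
  by rewrite ler_wpM2r ?expR_ge0// ler_norm.
rewrite mulNr expRN ltr_pdivrMr ?expR_gt0//.
rewrite ltr_pdivrMr ?mulr_gt0// in GC.
apply: (lt_trans GC); rewrite mulrCA [G * t]mulrC ltr_pM2l//.
by apply: lt_le_trans (expR_ge1Dx _); rewrite ltrDr.
Qed.

Theorem theorem2 (R : realType) (nu : probability R R) (mY sigma : R)
  (nu_nonneg : nu [set y : R | 0 <= y] = 1%E)
  (nu_2mom : (\int[nu]_y (y ^+ 2)%:E < +oo)%E)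
  (nu_mean : (\int[nu]_y y%:E)%E = mY%:E)
  (mY_gt0 : 0 < mY) (sigma_gt0 : 0 < sigma)
  (pi : R -> R -> probability R R)
  (pi_stat : forall eps Gamma, 0 < eps < mY -> 0 < Gamma ->
     stationary nu mY eps Gamma (pi eps Gamma)) :
  (forall eps, 0 < eps < mY ->
     ((ln (1 + (mY - eps) / sigma ^+ 2) / 2)%:E <=
      limf_einf (fun Gamma => rate nu mY sigma eps (pi eps Gamma))
                (pinfty_nbhs R))%E)
  /\
  ((fun Gamma => ereal_sup
      [set rate nu mY sigma eps (pi eps Gamma) | eps in [set e : R | 0 < e < mY]])
     @ pinfty_nbhs R --> (ln (1 + mY / sigma ^+ 2) / 2)%:E).
Proof.
pose L (x : R) := ln (1 + x / sigma ^+ 2) / 2.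
have lower eps e : 0 < eps < mY -> 0 < e -> \forall G \near pinfty_nbhs R,
    ((L (mY - eps) - e)%:E <= rate nu mY sigma eps (pi eps G))%E.
  move=> epsI e0.
  have [t [C [t0 H]]] := rate_ge_exp nu_nonneg nu_2mom nu_mean sigma_gt0 epsI.
  apply: filterS (near_pinfty_exp_lt C t0 e0) => G [G0 Ge].
  apply: le_trans (H _ _ G0 (pi_stat _ _ epsI G0)).
  by rewrite lee_fin lerD2l lerN2 ltW.
have Lmono x y : 0 <= x -> x <= y -> L x <= L y.
  move=> x0 xy; have k0 : 0 < (sigma ^+ 2)^-1 by rewrite invr_gt0 exprn_gt0.
  have y0 := le_trans x0 xy.
  rewrite /L ler_pM2r// ler_ln ?posrE ?ltr_wpDr ?mulr_ge0 ?(ltW k0)//.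
  by rewrite lerD2l ler_pM2r.
split.
  move=> eps epsI; rewrite limf_einfE; apply/lee_addgt0Pr => e e0.
  rewrite -leeBlDr// -EFinB.
  (* The lower limit is a supremum of infima over members of the filter; [A] is the member that
     witnesses the bound. *)
  pose A := [set G | ((L (mY - eps) - e)%:E <= rate nu mY sigma eps (pi eps G))%E].
  apply: (@le_trans _ _ (ereal_inf [set rate nu mY sigma eps (pi eps G) | G in A])).
    by apply: le_ereal_inf_tmp => _ [G HG <-].
  by apply: ereal_sup_ubound; exists A => //; exact: lower.
set S := fun _ => ereal_sup _.
have S_le G : (S G <= (L mY)%:E)%E.
  apply: ge_ereal_sup => _ [eps epsI <-]; apply: (le_trans (rate_le _ _ _ _)) => //.
  by rewrite lee_fin; case/andP: epsI => e0 em; apply: Lmono; lra.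
have S_ge e : 0 < e -> \forall G \near pinfty_nbhs R, ((L mY - e)%:E <= S G)%E.
  move=> e0; have [eps epsI Leps] : exists2 eps, 0 < eps < mY & L mY - e / 2 <= L (mY - eps).
    have k0 : 0 < sigma ^+ 2 by rewrite exprn_gt0.
    (* The first entry keeps [eps] below [mY]. The second caps the loss: since [b >= 1], [ln a - ln
       b <= a / b - 1 <= a - b = eps / sigma ^+ 2 <= e], and [L] halves it. *)
    pose eps := Num.min (mY / 2) (e * sigma ^+ 2).
    have eps0 : 0 < eps by rewrite lt_min divr_gt0 ?mulr_gt0.
    have eps1 : eps <= mY / 2 by rewrite ge_min lexx.
    have eps2 : eps / sigma ^+ 2 <= e by rewrite ler_pdivrMr// ge_min lexx orbT.
    exists eps; first by rewrite eps0/=; lra.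
    set a := 1 + mY / sigma ^+ 2; set b := 1 + (mY - eps) / sigma ^+ 2.
    have b1 : 1 <= b by rewrite lerDl divr_ge0// ?(ltW k0)//; lra.
    have a0 : 0 < a by rewrite ltr_pwDl// divr_ge0// ltW.
    have ab : a - b = eps / sigma ^+ 2 by rewrite /a /b; field; rewrite gt_eqF.
    have b0 : 0 < b by lra.
    have := ln_le_subr1 (divr_gt0 a0 b0); rewrite ln_div ?posrE//.
    have : a / b - 1 <= eps / sigma ^+ 2.
      rewrite lerBlDr ler_pdivrMr// mulrDl mul1r -lerBlDr ab ler_peMr//.
      by rewrite divr_ge0// ltW.
    by rewrite /L -/a -/b; lra.
  have e20 : 0 < e / 2 by rewrite divr_gt0.
  apply: filterS (lower eps _ epsI e20) => G HG.
  apply: (@le_trans _ _ (rate nu mY sigma eps (pi eps G))).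
    by apply: le_trans HG; rewrite lee_fin; lra.
  by apply: ereal_sup_ubound; exists eps.
(* Convergence in the extended reals splits into eventual finiteness, from the squeeze between
   [L mY - 1] and [L mY], and convergence of the real values. *)
apply/fine_cvgP; split.
  apply: filterS (S_ge 1 ltr01) => G HG.
  by rewrite fin_numElt (lt_le_trans _ HG) ?ltNyr// (le_lt_trans (S_le G)) ?ltry.
apply/cvgrPdist_le => e e0; apply: filterS (S_ge e e0) => G HG.
have Sfin : S G \is a fin_num.
  by rewrite fin_numElt (lt_le_trans _ HG) ?ltNyr// (le_lt_trans (S_le G)) ?ltry.
have := S_le G; move: HG; rewrite -(fineK Sfin) !lee_fin => H1 H2.
by rewrite /= ger0_norm ?subr_ge0// lerBlDr -lerBlDl.
Qed.
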